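(* Let $T,S:U\to U$ be diffeomorphisms of an open set $U\subseteq\mathbb{R}^n$, let $\mu\in\mathscr{P}(U)$ be both $T$-invariant and $S$-invariant, and suppose $\operatorname{supp}(\mu)\subseteq U$ is compact. Let $m\in\mathbb{N}$ satisfy $m>2d_\mu$, where $d_\mu=\operatorname{boxdim}(\operatorname{supp}(\mu))$. Assume that the periodic point condition (P) of the context, with parameter $m$ and $A=\operatorname{supp}(\mu)$, holds for both $T$ and $S$. Then for almost every $Y=(y_1,\dots,y_m)\in C^1(U,\mathbb{R}^m)$ (in the sense of prevalence) the following implication holds: if 1. there exists $x^*\in\mathcal{B}_{\mu,T}\cap\operatorname{supp}(\mu)$ such that $T^k(x^* )=S^k(x^* )$ for $1\le k\le m-1$, and 2. $\hat\mu^{(m+1)}_{(y_j,T)}=\hat\mu^{(m+1)}_{(y_j,S)}$ for $1\le j\le m$, then $T=S$ everywhere on $\operatorname{supp}(\mu)$.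
   Context: $\mathscr{P}(U)$ is the set of Borel probability measures on $U$. The pushforward of $\mu$ under a measurable $f$ is $(f\#\mu)(B):=\mu(f^{-1}(B))$; $\mu$ is $T$-invariant if $T\#\mu=\mu$. $\operatorname{supp}(\mu)$ is the smallest closed set of full $\mu$-measure. Basin of attraction of a $T$-invariant $\mu$ with compact support: $\mathcal{B}_{\mu,T}:=\{x\in U:\lim_{N\to\infty}\frac1N\sum_{k=0}^{N-1}\phi(T^k(x))=\int_U\phi\,d\mu\ \text{ for all }\phi\in C(U)\}$, where $C(U)$ is the set of continuous real-valued functions on $U$. Delay map: for $y:U\to\mathbb{R}$ and $k\in\mathbb{N}$, $\Psi^{(k)}_{(y,T)}(x):=(y(x),y(T(x)),\dots,y(T^{k-1}(x)))\in\mathbb{R}^k$. The delay-coordinate invariant measure is $\hat\mu^{(k)}_{(y,T)}:=\Psi^{(k)}_{(y,T)}\#\mu\in\mathscr{P}(\mathbb{R}^k)$, and likewise $\hat\mu^{(k)}_{(y,S)}:=\Psi^{(k)}_{(y,S)}\#\mu$. Box-counting dimension of a compact $A\subseteq\mathbb{R}^n$: $\operatorname{boxdim}(A):=\lim_{\varepsilon\to0}\frac{\log N(\varepsilon)}{\log(1/\varepsilon)}$, where $N(\varepsilon)$ is the number of boxes of side-length $\varepsilon$ required to cover $A$. Periodic point condition (P) for a diffeomorphism $T$ of $U$, a compact set $A\subseteq U$ and $m\in\mathbb{N}$: for each integer $1\le p\le m$, (1) the set $A_p\subseteq A$ of $p$-periodic points (points $x\in A$ with $T^p(x)=x$) satisfies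 $\operatorname{boxdim}(A_p)<p/2$; (2) the linearization $DT^p$ (the derivative of the $p$-fold composition $T^p$) of each such periodic orbit has distinct eigenvalues. Prevalence: a Borel subset $G$ of a completely metrizable topological vector space $V$ is prevalent if there is a finite-dimensional subspace $E\subseteq V$ (a probe space) such that for each $v\in V$ one has $v+e\in G$ for Lebesgue almost every $e\in E$ (Lebesgue measure on $E$ via coordinates in a basis). A property holds for almost every $Y\in V$ if it holds for all $Y$ in a prevalent set. $C^1(U,\mathbb{R}^m)$ carries the usual topology of uniform convergence of functions and first derivatives on compact subsets of $U$. *)

(* Defs.v *)
From HB Require Import structures.
From mathcomp Require Import all_boot all_order all_algebra.
From mathcomp.real_closed Require Import complex.
From mathcomp Require Import all_classical all_reals all_analysis.

Set Implicit Arguments.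
Unset Strict Implicit.
Unset Printing Implicit Defensive.

Import Order.TTheory GRing.Theory Num.Theory.
Import numFieldNormedType.Exports.
Local Open Scope classical_set_scope.
Local Open Scope ring_scope.

Section C1_maps.
Context {R : realType} {n m : nat}.
Implicit Types (U : set 'rV[R]_n) (f g : 'rV[R]_n -> 'rV[R]_m).

(* Used for open U only, where differentiability at the points of U and the
   value of the Jacobian there do not depend on f outside of U. *)
Definition C1_on U f :=
  (forall x, U x -> differentiable f x) /\
  {within U, continuous (jacobian f)}.

Let jacobianE f x i j : jacobian f x i j = 'd f x (delta_mx 0 i) 0 j.
Proof. by rewrite /jacobian /lin1_mx mxE. Qed.

Let addmxE p q (A B : 'M[R]_(p, q)) i j : (A + B) i j = A i j + B i j.
Proof. by rewrite mxE. Qed.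

Let scalemxE p q a (A : 'M[R]_(p, q)) i j : (a *: A) i j = a * A i j.
Proof. by rewrite mxE. Qed.

Let eval_d i j (h : 'rV[R]_n -> 'rV[R]_m) := h (delta_mx 0 i) 0 j.

Lemma jacobianD f g x : differentiable f x -> differentiable g x ->
  jacobian (f + g) x = jacobian f x + jacobian g x.
Proof.
move=> df dg; apply/matrixP => i j; apply: (etrans (jacobianE _ _ _ _)).
apply/esym/(etrans (addmxE _ _ _ _)).
apply: (etrans (f_equal2 +%R (jacobianE f x i j) (jacobianE g x i j))).
apply: (etrans (esym (addmxE _ _ _ _))).
exact: (f_equal (eval_d i j) (esym (diffD df dg))).
Qed.

Lemma jacobianZ a f x : differentiable f x ->
  jacobian (a *: f) x = a *: jacobian f x.
Proof.
move=> df; apply/matrixP => i j; apply: (etrans (jacobianE _ _ _ _)).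
apply/esym/(etrans (scalemxE _ _ _ _)).
apply: (etrans (f_equal ( *%R a) (jacobianE f x i j))).
apply: (etrans (esym (scalemxE _ _ _ _))).
exact: (f_equal (eval_d i j) (esym (diffZ a df))).
Qed.

Lemma jacobian0 x : jacobian (0 : 'rV[R]_n -> 'rV[R]_m) x = 0.
Proof.
have d0 : differentiable (0 : 'rV[R]_n -> 'rV[R]_m) x.
  by exact: differentiable_cst.
have := jacobianZ 0 d0; rewrite scale0r => E.
by apply: (etrans E); rewrite scale0r.
Qed.

Lemma C1_on0 U : C1_on U 0.
Proof.
split; first by move=> x _; exact: differentiable_cst.
apply: (@subspace_eq_continuous 'rV[R]_n U 'M[R]_(n, m) (fun=> 0)
  (jacobian 0)).
  by move=> x _; rewrite -[LHS](jacobian0 x).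
by move=> x; exact: cvg_cst.
Qed.

Lemma C1_onD U f g : C1_on U f -> C1_on U g -> C1_on U (f + g).
Proof.
move=> [df cf] [dg cg]; split.
  by move=> x Ux; apply: differentiableD; [exact: df|exact: dg].
apply: (@subspace_eq_continuous _ U _ (jacobian f \+ jacobian g)).
  by move=> x /set_mem Ux; apply/esym/jacobianD; [exact: df|exact: dg].
by move=> x; apply: cvgD; [exact: cf|exact: cg].
Qed.

Lemma C1_onZ U a f : C1_on U f -> C1_on U (a *: f).
Proof.
move=> [df cf]; split.
  by move=> x Ux; apply: differentiableZ; exact: df.
apply: (@subspace_eq_continuous _ U _ (a \*: jacobian f)).
  by move=> x /set_mem Ux; apply/esym/jacobianZ; exact: df.
by move=> x; apply: cvgZr; exact: cf.
Qed.

End C1_maps.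

Section C1_space.
Context {R : realType} {n : nat} (U : set 'rV[R]_n) (m : nat).

(* An element of C^1(U, R^m) is represented by its extension by 0 to R^n: each
   C^1 map on U has exactly one such representative. *)
Definition C1_pred : {pred 'rV[R]_n -> 'rV[R]_m} :=
  mem [set f | C1_on U f /\ forall x, ~ U x -> f x = 0].

Record C1_space := MkC1 {
  C1_fun :> 'rV[R]_n -> 'rV[R]_m ;
  C1_funP : C1_fun \in C1_pred }.

HB.instance Definition _ := [isSub for C1_fun].
HB.instance Definition _ := [Choice of C1_space by <:].

Let C1_submod_closed : submod_closed C1_pred.
Proof.
split; first by rewrite inE; split; [exact: C1_on0|].
move=> a f g; rewrite !inE => -[Cf f0] [Cg g0]; split.
  exact: (C1_onD (C1_onZ a Cf) Cg).
move=> x Ux; rewrite -[LHS]/(a *: f x + g x).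
by rewrite f0// g0// scaler0 addr0.
Qed.

HB.instance Definition _ :=
  GRing.isSubmodClosed.Build R ('rV[R]_n -> 'rV[R]_m) C1_pred C1_submod_closed.
HB.instance Definition _ := [SubChoice_isSubLmodule of C1_space by <:].

Local Notation family := [set K : set 'rV[R]_n | compact K /\ K `<=` U].

(* The topology is induced by f |-> (f, Df), the target carrying uniform
   convergence on the compact subsets of U; see C1_cvgP below. *)
Definition C1_jet (f : C1_space) :
    {family family, 'rV[R]_n -> 'rV[R]_m} *
    {family family, 'rV[R]_n -> 'M[R]_(n, m)} :=
  (C1_fun f, jacobian f).

HB.instance Definition _ :=
  Topological.copy C1_space (initial_topology C1_jet).
End C1_space.

Section C1_topology.
Context {R : realType}.

Lemma family_cvg_normP (T : choiceType) (V : normedModType R)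
    (fam : set T -> Prop) (F : set_system (T -> V)) (f : T -> V) : Filter F ->
  {family fam, F --> f} <->
  forall K e, fam K -> 0 < e ->
    \forall g \near F, forall x, K x -> `|f x - g x| < e.
Proof.
move=> FF; split.
  move=> /fam_cvgP Ff K e famK e0; apply: (Ff K famK).
  apply/uniform_nbhs; exists [set xy | ball xy.1 e xy.2]; split.
    exact: entourage_ball (PosNum e0).
  by move=> g /= + x Kx => /(_ x Kx); rewrite -ball_normE.
move=> Ff; apply/fam_cvgP => K famK P /uniform_nbhs[E [entE EP]].
move: entE; rewrite -entourage_ballE => -[e /= e0 eE].
have := Ff K e famK e0; apply: filterS => g fg; apply: EP => x Kx.
by apply: eE => /=; rewrite -ball_normE; exact: fg.
Qed.

Context {n : nat} {U : set 'rV[R]_n} {m : nat}.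
Notation C1 := (C1_space U m).

Lemma C1_cvgP (F : set_system C1) (f : C1) : Filter F ->
  F --> f <->
  forall K e, compact K -> K `<=` U -> 0 < e ->
    F [set g : C1 | forall x, K x ->
      `|f x - g x| < e /\ `|jacobian (C1_fun f) x - jacobian (C1_fun g) x| < e].
Proof.
move=> FF.
have -> : (F --> f) <-> (@C1_jet _ _ U m @ F --> C1_jet f).
  split=> [Ff|jF].
    move=> A jA; apply: Ff.
    exact: (@initial_continuous _ _ (@C1_jet _ _ U m) f A jA).
  move=> A; rewrite {1}nbhsE => -[B [[C oC <-] Cf] CA].
  by apply: (filterS CA); apply: jF; exact: open_nbhs_nbhs.
have -> : (@C1_jet _ _ U m @ F --> C1_jet f) <->
    ((fun g : C1 => (C1_jet g).1) @ F --> (C1_jet f).1 /\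
     (fun g : C1 => (C1_jet g).2) @ F --> (C1_jet f).2).
  split=> [jF|[F1 F2]].
    split=> A nA; [apply: (jF (fst @^-1` A))|apply: (jF (snd @^-1` A))].
      exact: (@cvg_fst _ _ (nbhs (C1_jet f).1) (nbhs (C1_jet f).2) _ A nA).
    exact: (@cvg_snd _ _ (nbhs (C1_jet f).1) (nbhs (C1_jet f).2) _ A nA).
  exact: (cvg_pair F1 F2).
have P1 := family_cvg_normP [set K | compact K /\ K `<=` U] (C1_fun f)
  (fmap_filter (fun g : C1 => C1_fun g) FF).
have P2 := family_cvg_normP [set K | compact K /\ K `<=` U]
  (jacobian (C1_fun f)) (fmap_filter (fun g : C1 => jacobian (C1_fun g)) FF).
split=> [[/P1 H1 /P2 H2] K e cK KU e0|H].
  have h1 : F [set g : C1 | forall x, K x -> `|f x - g x| < e].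
    exact: H1 (conj cK KU) e0.
  have h2 : F [set g : C1 | forall x, K x ->
      `|jacobian (C1_fun f) x - jacobian (C1_fun g) x| < e].
    exact: H2 (conj cK KU) e0.
  apply: filterS (filterI h1 h2) => g [/= g1 g2] x Kx.
  by split; [exact: g1|exact: g2].
split; [apply/P1|apply/P2] => K e [cK KU] e0; have HF := H _ _ cK KU e0.
  suff : F [set g : C1 | forall x, K x -> `|f x - g x| < e] by [].
  by apply: filterS HF => g /= Hg x Kx; have [] := Hg x Kx.
suff : F [set g : C1 | forall x, K x ->
    `|jacobian (C1_fun f) x - jacobian (C1_fun g) x| < e] by [].
by apply: filterS HF => g /= Hg x Kx; have [] := Hg x Kx.
Qed.

Lemma C1_bounded (f : C1) K : compact K -> K `<=` U ->
  exists2 M, 0 < M &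
    forall x, K x -> `|f x| <= M /\ `|jacobian (C1_fun f) x| <= M.
Proof.
move=> cK KU; have := C1_funP f; rewrite inE => -[[df cf] _].
have B (V : normedModType R) (h : 'rV[R]_n -> V) : {within K, continuous h} ->
    exists M, forall x, K x -> `|h x| <= M.
  move=> ch; have /compact_bounded[M [_ HM]] := continuous_compact ch cK.
  by exists (M + 1) => x Kx; apply: HM; [rewrite ltrDl|exists x].
have [M1 H1] : exists M, forall x, K x -> `|f x| <= M.
  apply: B; apply: continuous_in_subspaceT => x /set_mem/KU Ux.
  exact/differentiable_continuous/df.
have [M2 H2] := B _ _ (continuous_subspaceW KU cf).
exists (`|M1| + `|M2| + 1) => [|x Kx].
  by rewrite ltr_wpDl// addr_ge0.
split; [apply: (le_trans (H1 _ Kx))|apply: (le_trans (H2 _ Kx))].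
  by rewrite -addrA ler_wpDr ?ler_norm// addr_ge0.
by rewrite addrAC ler_wpDl ?ler_norm// addr_ge0.
Qed.

Lemma C1_differentiable (f : C1) x : U x -> differentiable f x.
Proof. by move=> Ux; have := C1_funP f; rewrite inE => -[[+ _] _]; apply. Qed.

Let normD4 (V : normedModType R) (a b c d : V) e :
  `|a - c| < e / 2 -> `|b - d| < e / 2 -> `|(a + b) - (c + d)| < e.
Proof.
move=> h1 h2; rewrite opprD addrACA (le_lt_trans (ler_normD _ _))//.
by rewrite (splitr e) ltrD.
Qed.

Lemma C1_add_continuous : continuous (fun p : C1 * C1 => p.1 + p.2).
Proof.
move=> [f g]; apply/(C1_cvgP _ (fmap_filter _ _)) => K e cK KU e0.
have e20 : 0 < e / 2 by rewrite divr_gt0.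
have Hf := (C1_cvgP f (nbhs_filter f)).1 cvg_id K _ cK KU e20.
have Hg := (C1_cvgP g (nbhs_filter g)).1 cvg_id K _ cK KU e20.
exists ([set f' : C1 | forall x, K x -> `|f x - f' x| < e / 2 /\
                 `|jacobian (C1_fun f) x - jacobian (C1_fun f') x| < e / 2],
        [set g' : C1 | forall x, K x -> `|g x - g' x| < e / 2 /\
                 `|jacobian (C1_fun g) x - jacobian (C1_fun g') x| < e / 2]).
  by split; [exact: Hf|exact: Hg].
move=> [f' g'] [Hf' Hg'] x Kx; have Ux := KU _ Kx.
have [f0 f1] := Hf' x Kx; have [g0 g1] := Hg' x Kx; split.
  exact: normD4.
have D (h k : C1) : jacobian (C1_fun (h + k)) x =
    jacobian (C1_fun h) x + jacobian (C1_fun k) x.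
  exact: (jacobianD (C1_differentiable h Ux) (C1_differentiable k Ux)).
have E := f_equal2 (fun u v => `|u - v|) (D f g) (D f' g').
have L := normD4 f1 g1.
exact: (eq_rect_r (fun r : R => is_true (r < e)) L E).
Qed.

Lemma C1_scale_continuous : continuous (fun p : R^o * C1 => p.1 *: p.2).
Proof.
move=> [a f]; apply/(C1_cvgP _ (fmap_filter _ _)) => K e cK KU e0.
have [M M0 fM] := C1_bounded f cK KU.
pose d := Num.min 1 (e / (2 * (M + 1 + `|a|))).
have MaP : 0 < M + 1 + `|a| by rewrite ltr_wpDr// addr_gt0.
have d0 : 0 < d by rewrite lt_min ltr01 divr_gt0// mulr_gt0.
have Hf := (C1_cvgP f (nbhs_filter f)).1 cvg_id K _ cK KU d0.
exists (ball (a : R^o) d,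
        [set f' : C1 | forall x, K x -> `|f x - f' x| < d /\
                 `|jacobian (C1_fun f) x - jacobian (C1_fun f') x| < d]).
  by split; [exact: nbhsx_ballx|exact: Hf].
move=> [b f'] [ab Hf'] x Kx; have Ux := KU _ Kx.
have key (V : normedModType R) (v v' : V) : `|v| <= M -> `|v - v'| < d ->
    `|a *: v - b *: v'| < e.
  move=> vM vv'; rewrite -(subrKA (a *: v')) -scalerBr -scalerBl.
  rewrite (le_lt_trans (ler_normD _ _))// !normrZ.
  have d1 : d <= 1 by rewrite ge_min lexx.
  have v'M : `|v'| <= M + 1.
    rewrite -[v'](subKr v) (le_trans (ler_normB _ _))// lerD//.
    exact: ltW (lt_le_trans vv' d1).
  have abd : `|a - b| < d by move: ab; rewrite -ball_normE.
  apply: (@le_lt_trans _ _ ((M + 1 + `|a|) * d)).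
    rewrite mulrDl addrC lerD//.
      by rewrite mulrC ler_pM// ltW.
    by rewrite ler_wpM2l// ltW.
  rewrite -ltr_pdivlMl// (@le_lt_trans _ _ (e / (2 * (M + 1 + `|a|))))//.
    by rewrite ge_min lexx orbT.
  by rewrite mulrC ltr_pM2r// ltf_pV2 ?posrE ?mulr_gt0// ltr_pMl// ltr1n.
have [f0 f1] := Hf' x Kx; have [M1 M2] := fM x Kx; split.
  exact: key.
have Z (c : R) (h : C1) : jacobian (C1_fun (c *: h)) x =
    c *: jacobian (C1_fun h) x.
  exact: (jacobianZ c (C1_differentiable h Ux)).
have E := f_equal2 (fun u v => `|u - v|) (Z a f) (Z b f').
have L := key _ _ _ M2 f1.
exact: (eq_rect_r (fun r : R => is_true (r < e)) L E).
Qed.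

HB.instance Definition _ :=
  PreTopologicalNmodule_isTopologicalNmodule.Build C1 C1_add_continuous.
HB.instance Definition _ :=
  TopologicalNmodule_isTopologicalLmodule.Build R C1 C1_scale_continuous.
End C1_topology.

Section lebesgue_tuple.
Context {R : realType}.
Local Notation T := (measurableTypeR R).

Section step.
Context k (mu : {sigma_finite_measure set (k.-tuple T) -> \bar R}).

Definition tcons (p : T * k.-tuple T) : k.+1.-tuple T := [tuple of p.1 :: p.2].

Let measurable_tcons : measurable_fun setT tcons.
Proof. exact: (@measurable_cons _ _ _ _ fst k snd). Qed.

Definition lebesgue_cons : set (k.+1.-tuple T) -> \bar R :=
  pushforward (@lebesgue_measure R \x mu)%E tcons.

Let lebesgue_cons0 : lebesgue_cons set0 = 0%E.
Proof. by rewrite /lebesgue_cons /pushforward preimage_set0 measure0. Qed.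

Let lebesgue_cons_ge0 A : (0 <= lebesgue_cons A)%E.
Proof. exact: measure_ge0. Qed.

Let lebesgue_cons_sigma_additive : semi_sigma_additive lebesgue_cons.
Proof.
move=> F mF tF mUF; rewrite /lebesgue_cons /pushforward preimage_bigcup.
apply: measure_semi_sigma_additive.
- by move=> i; rewrite -[X in measurable X]setTI; exact: measurable_tcons.
- apply/trivIsetP => /= i j _ _ ij; rewrite -preimage_setI.
  by move/trivIsetP : tF => /(_ _ _ _ _ ij) ->//; rewrite preimage_set0.
- rewrite -preimage_bigcup -[X in measurable X]setTI.
  exact: measurable_tcons.
Qed.

HB.instance Definition _ := isMeasure.Build _ _ _ lebesgue_cons
  lebesgue_cons0 lebesgue_cons_ge0 lebesgue_cons_sigma_additive.

Let sigma_finite_lebesgue_cons : sigma_finite setT lebesgue_cons.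
Proof.
have /sigma_finiteP[F [FT ndF Foo]] := sigma_finiteT (@lebesgue_measure R).
have /sigma_finiteP[G [GT ndG Goo]] := sigma_finiteT mu.
pose g (t : k.+1.-tuple T) : T * k.-tuple T := (thead t, [tuple of behead t]).
have gK : cancel tcons g by move=> [x t]; congr pair; apply: val_inj.
have mg : measurable_fun setT g.
  apply: measurable_fun_pair; first exact: measurable_tnth.
  exact: measurable_behead.
exists (fun i => g @^-1` (F i `*` G i)).
  rewrite -preimage_bigcup (_ : \bigcup_i _ = setT) ?preimage_setT//.
  rewrite -subTset => -[x y] _.
  have [i _ Fix] : (\bigcup_i F i) x by rewrite -FT.
  have [j _ Gjy] : (\bigcup_i G i) y by rewrite -GT.
  exists (maxn i j) => //; split.
    by move: x Fix; exact/subsetPset/ndF/leq_maxl.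
  by move: y Gjy; exact/subsetPset/ndG/leq_maxr.
move=> i; have [mF Fioo] := Foo i; have [mG Gioo] := Goo i; split.
  by rewrite -[X in measurable X]setTI; apply: mg => //; exact: measurableX.
rewrite /lebesgue_cons /pushforward.
rewrite (_ : _ @^-1` _ = F i `*` G i); last first.
  rewrite -[LHS]/((g \o tcons) @^-1` _) (_ : g \o tcons = id)//.
  exact/funext.
by rewrite product_measure1E// lte_mul_pinfty// ge0_fin_numE.
Qed.

HB.instance Definition _ :=
  Measure_isSigmaFinite.Build _ _ _ lebesgue_cons sigma_finite_lebesgue_cons.
End step.

(* Lebesgue measure on R^k as the k-fold product of lebesgue_measure. *)
Fixpoint lebesgue_tuple k : {sigma_finite_measure set (k.-tuple T) -> \bar R} :=
  match k with
  | 0 => \d_[tuple]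
  | k'.+1 => lebesgue_cons (lebesgue_tuple k')
  end.
End lebesgue_tuple.

Section prevalence.
Context {R : realType} {V : topologicalLmodType R}.

(* The probe space is the span of the linearly independent vectors e, with
   Lebesgue measure transported by the coordinates c in that basis. Complete
   metrizability of V is not a hypothesis of the definition. *)
Definition prevalent (G : set V) :=
  <<s @open V >> G /\
  exists k (e : 'I_k -> V),
    (forall c : 'I_k -> R, \sum_i c i *: e i = 0 -> forall i, c i = 0) /\
    forall v : V, {ae @lebesgue_tuple R k,
      forall c : k.-tuple (measurableTypeR R),
        G (v + \sum_i (tnth c i : R) *: e i)}.

Definition for_almost_every (P : V -> Prop) :=
  exists2 G : set V, prevalent G & forall Y, G Y -> P Y.

End prevalence.

Notation borel X := (g_sigma_algebraType (@open X)).

Section dynamics.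
Context {R : realType} {n : nat}.
Local Notation E := ('rV[R]_n).
Implicit Types (U A : set E) (T : E -> E) (mu : probability (borel E) R).

(* Self-maps of U are represented by total maps on R^n of which only the values
   on U matter, and P(U) by the Borel probability measures mu on R^n such that
   mu U = 1. *)
Definition diffeomorphism_on U T :=
  exists T', [/\ forall x, U x -> U (T x), forall x, U x -> U (T' x),
    forall x, U x -> T' (T x) = x, forall x, U x -> T (T' x) = x
    & C1_on U T /\ C1_on U T'].

Definition pushforward_on mu U k (f : E -> 'rV[R]_k) (B : set (borel 'rV[R]_k))
  : \bar R := mu (U `&` f @^-1` B).

Definition invariant_on mu U T :=
  forall B : set (borel E), measurable B -> pushforward_on mu U T B = mu B.

Definition supp mu : set E :=
  \bigcap_(F in [set F : set E | closed F /\ mu F = 1%E]) F.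

Definition basin mu U T : set E :=
  [set x | U x /\ forall phi : E -> R, {within U, continuous phi} ->
    (fun N : nat => N%:R^-1 * \sum_(k < N) phi (iter k T x)) @ \oo -->
      \int[mu]_(z in U) phi z].

Definition delay_map k (y : E -> R) T (x : E) : 'rV[R]_k :=
  \row_(i < k) y (iter i T x).

Definition delay_measure mu U k (y : E -> R) T :
    set (borel 'rV[R]_k) -> \bar R :=
  pushforward_on mu U (delay_map k y T).

Definition box (c : E) (eps : R) : set E :=
  [set x | forall i, c 0 i <= x 0 i <= c 0 i + eps].

Definition box_number A (eps : R) : R :=
  inf [set k%:R | k in [set k : nat |
    exists c : 'I_k -> E, A `<=` \bigcup_(j in setT) box (c j) eps]].

(* The limit defining the dimension is required to exist. As ln 0 = 0, the empty
   set has dimension 0 here. *)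
Definition has_boxdim A (d : R) :=
  ln (box_number A eps) / ln eps^-1 @[eps --> 0^'+] --> d.

Definition periodic_points T A p : set E := [set x | A x /\ iter p T x = x].

(* The n complex eigenvalues of the real matrix M are pairwise distinct. *)
Definition distinct_eigenvalues (M : 'M[R]_n) :=
  exists s : seq (complex R), [/\ uniq s, size s = n
    & all (eigenvalue (map_mx (real_complex R) M)) s].

Definition periodic_point_condition T A m :=
  forall p, (1 <= p <= m)%N ->
    (exists2 d, has_boxdim (periodic_points T A p) d & d < p%:R / 2) /\
    (forall x, periodic_points T A p x ->
       distinct_eigenvalues (jacobian (iter p T) x)).

End dynamics.

(* Main.v *)
Require Import Defs.
From mathcomp Require Import all_boot all_order all_algebra.
From mathcomp Require Import all_classical all_reals all_analysis.
From mathcomp Require Import ring lra measurable_realfun.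

(* No embedding theorem is needed, and a single coordinate y of Y suffices.
   Fix z in A = supp mu. For almost every y, no other point w of A has the same
   first m delay coordinates under S as z: agreement of the first q of them, q
   being m or the period of w, imposes q independent conditions on y, whereas
   such w range over a set of box dimension < q.
   Let x be the given basin point and suppose T^i x = S^i x for i < k, where
   k >= m. Put z = T^(k-m) x. Equality of the delay measures gives w in A with
   y(T^i z) = y(S^i w) for i <= m. As T^i z = S^i z for i < m, the first m delay
   coordinates of w and z under S agree, so w = z and y(T^k x) = y(S^k x);
   almost every y separates these two points unless they are equal. Hence T and
   S agree along the whole orbit of x. The integral of min(1, |T - S|) is its
   average along this orbit, i.e. 0, so T = S on A. *)

Set Implicit Arguments.
Unset Strict Implicit.
Unset Printing Implicit Defensive.

Import Order.TTheory GRing.Theory Num.Theory.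
Import numFieldNormedType.Exports.
Local Open Scope classical_set_scope.
Local Open Scope ring_scope.

(** * Lebesgue measure on tuples *)

(** Hypothesis 1 does not mention Y, so x is fixed before the prevalent set is chosen, and only the
    countably many points z = T^k x and pairs T^k x, S^k x have to be handled. The obstacle is that
    prevalence asks for a Borel set and for one probe space serving all of them. The Borel set is a
    countable intersection of open sets, one for each z and each compact set K of points w to be
    separated from z. Compactness of K makes separation an open condition. It also forces K to stay
    away from z and from the points whose orbit segment nearly repeats itself or nearly meets that
    of z: hence countably many pieces, with gaps 1 / (j + 1). The probe space consists of
    polynomials of degree at most 2m, placed in one coordinate of Y. They interpolate arbitrary
    values at the points S^l w, l < q, and vanish at the points S^l z. This is the independence of
    the q conditions. *)

Lemma exists_pushforward d d' (T1 : measurableType d) (T2 : measurableType d')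
    (R : realType) (m : {measure set T1 -> \bar R}) (f : T1 -> T2) :
  measurable_fun setT f ->
  exists m' : {measure set T2 -> \bar R}, forall A, m' A = m (f @^-1` A).
Proof.
move=> mf.
by exists (measure_function_pushforward__canonical__measure_function_Measure m
  mf).
Qed.

Section lebesgue_tuple_theory.
Context {R : realType}.
Local Notation T := (measurableTypeR R).

Lemma measurable_addr (a : R) : measurable_fun setT (fun x : T => x + a : T).
Proof.
by apply: measurable_funD.
Qed.

Lemma lebesgue_measure_addr (a : R) (A : set T) : measurable A ->
  lebesgue_measure ((fun x : T => x + a : T) @^-1` A) = lebesgue_measure A.
Proof.
move=> mA.
have [m' m'E] := exists_pushforward (@lebesgue_measure R) (measurable_addr a).
rewrite -m'E; apply/esym/lebesgue_measure_unique => // _ [[b c] _ <-]/=.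
rewrite m'E.
have -> : (fun x : T => x + a : T) @^-1` `]b, c]%classic =
  `]b - a, c - a]%classic.
  apply/seteqP; split=> x /=; rewrite !in_itv/= => /andP[bx xc]; apply/andP;
    split; lra.
apply: (etrans (lebesgue_measure_itv _)); apply/esym.
apply: (etrans (lebesgue_measure_itv _)) => /=; rewrite !lte_fin ltrD2r.
by case: ifP => // _; rewrite -!EFinD; congr (_%:E); ring.
Qed.

Definition tuple_add k (s : 'I_k -> R) (c : k.-tuple T) : k.-tuple T :=
  [tuple (tnth c i : R) + s i | i < k].

Lemma measurable_tuple_add k (s : 'I_k -> R) :
  measurable_fun setT (@tuple_add k s).
Proof.
apply/measurable_fun_tnthP => i.
rewrite (_ : _ \o _ = (fun x : T => x + s i : T) \o (@tnth k T ^~ i)).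
  apply: measurableT_comp; first exact: measurable_addr.
  exact: measurable_tnth.
by apply/funext => c /=; rewrite tnth_mktuple.
Qed.

Lemma lebesgue_tupleS k (A : set (k.+1.-tuple T)) :
  lebesgue_tuple k.+1 A = (lebesgue_measure \x lebesgue_tuple k)%E
    (@tcons R k @^-1` A).
Proof. by []. Qed.

(** By induction on [k]: uniqueness of the product measure reduces the claim to rectangles. *)
Lemma lebesgue_tuple_add k (s : 'I_k -> R) (A : set (k.-tuple T)) :
  measurable A ->
  lebesgue_tuple k (tuple_add s @^-1` A) = lebesgue_tuple k A.
Proof.
elim: k s A => [|k IH] s A mA.
  rewrite (_ : tuple_add s = id) //.
  by apply/funext => c; apply: eq_from_tnth; case.
pose mu := lebesgue_tuple (R := R) k.
pose s' := fun i => s (lift ord0 i).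
pose f (p : T * k.-tuple T) : T * k.-tuple T :=
  ((p.1 : R) + s ord0, tuple_add s' p.2).
have mf : measurable_fun setT f.
  apply: measurable_fun_pair.
    by apply: measurableT_comp (measurable_addr _) _.
  by apply: measurableT_comp (measurable_tuple_add _) _.
have mt : measurable_fun setT (@tcons R k).
  exact: (@measurable_cons _ _ _ _ fst k snd).
have [m' m'E] := exists_pushforward (@lebesgue_measure R \x mu)%E mf.
have E : @tcons R k \o f = tuple_add s \o @tcons R k.
  apply/funext => -[x c]; apply: eq_from_tnth => i /=.
  rewrite tnth_mktuple /tcons /f /=.
  case: (unliftP ord0 i) => [j|] -> /=; last by rewrite !(tnth_nth 0)/=.
  by rewrite !tnthS tnth_mktuple.
rewrite !lebesgue_tupleS -comp_preimage -E comp_preimage -m'E.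
apply/esym/product_measure_unique.
  move=> B C mB mC; rewrite m'E.
  rewrite (_ : f @^-1` _ = ((fun x : T => x + s ord0 : T) @^-1` B) `*`
    (tuple_add s' @^-1` C)) //.
  apply: (etrans (product_measure1E _ _ _ _)).
  3: by congr (_ * _)%E; [exact: lebesgue_measure_addr|exact: IH].
  - by rewrite -[X in measurable X]setTI; exact: measurable_addr.
  - by rewrite -[X in measurable X]setTI; exact: measurable_tuple_add.
by rewrite -[X in measurable X]setTI; exact: mt.
Qed.

Definition cube k (r : R) : set (k.-tuple T) :=
  [set c | forall i, `|tnth c i : R| <= r].

Lemma measurable_cube k r : measurable (@cube k r).
Proof.
rewrite (_ : cube r = \bigcap_(i in @setT 'I_k)
  (@tnth k T ^~ i @^-1` `[- r, r])).
  apply: fin_bigcap_measurable => // i _.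
  rewrite -[X in measurable X]setTI.
  by apply: measurable_tnth => //; exact: measurable_itv.
apply/seteqP; split=> c /= h i.
  by move=> _ /=; rewrite in_itv/= -ler_norml.
by have := h i I; rewrite /= in_itv/= -ler_norml.
Qed.

Lemma lebesgue_cube_lty k r : (lebesgue_tuple k (@cube k r) < +oo)%E.
Proof.
elim: k => [|k IH].
  by rewrite [X in (X < _)%E]diracE ltry.
rewrite lebesgue_tupleS (_ : _ @^-1` _ = `[- r, r] `*` @cube k r); last first.
  apply/seteqP; split=> -[x c] /=.
    move=> h; split.
      by have := h ord0; rewrite (tnth_nth 0)/= in_itv/= ler_norml.
    by move=> i; have := h (lift ord0 i); rewrite tnthS.
  move=> [h1 h2] i; case: (unliftP ord0 i) => [j|] -> /=.
    by rewrite tnthS.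
  by rewrite (tnth_nth 0)/= ler_norml -[_ && _]/(x \in `[- r, r]).
rewrite product_measure1E//; last exact: measurable_cube.
have itv_lty : (lebesgue_measure ([set` `[- r, r]%R]%classic : set T) < +oo)%E.
  apply: (eq_rect_r (fun x => x < +oo)%E _ (lebesgue_measure_itv _)) => /=.
  by case: ifP => _; rewrite ?ltry.
by apply: lte_mul_pinfty => //; rewrite ge0_fin_numE.
Qed.

(* The translates of B by 3 eta (sum_j p_j u_j), 0 <= p_j < N, are disjoint,
   because g separates them, and lie in a fixed cube. *)
Lemma packing_translates k q (g : k.-tuple T -> 'I_q -> R)
  (u : 'I_q -> 'I_k -> R)
    (B : set (k.-tuple T)) (r eta W : R) (N : nat) :
  measurable B -> 0 < eta -> B `<=` @cube k r ->
  (forall c j, B c -> `|g c j| <= eta) ->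
  (forall j i, `|u j i| <= W) ->
  (forall c (t : 'I_q -> R) l, (forall j, `|t j| <= `|t l|) ->
     `|g (tuple_add (fun i => \sum_j t j * u j i) c) l - g c l - t l|
       <= `|t l| / 4) ->
  3 * eta * N%:R <= 6 ->
  (((N ^ q)%:R%:E * lebesgue_tuple k B) <=
    lebesgue_tuple k (cube (r + q%:R * (6 * W))%R))%E.
Proof.
move=> mB eta0 Br gB uW gu N6.
pose t (p : {ffun 'I_q -> 'I_N}) j : R := 3 * eta * (p j)%:R.
pose s (p : {ffun 'I_q -> 'I_N}) i := \sum_j t p j * u j i.
pose F p := @tuple_add k (s p) @^-1` B.
have mF p : measurable (F p).
  by rewrite -[X in measurable X]setTI; exact: measurable_tuple_add.
have tF : trivIset setT F.
  apply/trivIsetP => p p' _ _ pp'; rewrite -subset0 => c [Fp Fp'].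
  have [j0 pj0] : exists j0, p j0 != p' j0.
    by apply/existsP; rewrite -negb_forall; apply: contra pp' => /forallP pE;
      apply/eqP/ffunP => j; exact/eqP.
  (* Suppose that [c] lies in two translates and let [l] maximize [|d l|]. The two values of [g]
     differ by at most 2 [eta], but also by at least 3/4 of [|d l| >= 3 * eta], that is, by 9/4
     [eta]. *)
  pose d j := t p' j - t p j.
  have [l _ dl] := @arg_maxP _ _ _ j0 xpredT (fun j => `|d j|) isT.
  have dmax j : `|d j| <= `|d l| by exact: (dl j isT).
  have := gu (tuple_add (s p) c) d l dmax.
  rewrite (_ : tuple_add _ _ = tuple_add (s p') c); last first.
    apply: eq_from_tnth => i; rewrite !tnth_mktuple -addrA; congr (_ + _).
    rewrite /s -big_split/=; apply: eq_bigr => j _; rewrite /d; ring.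
  have d3 : 3 * eta <= `|d l|.
    apply: le_trans (dmax j0); rewrite /d /t -mulrBr normrM gtr0_norm; last lra.
    rewrite ler_peMr//; first lra.
    move: pj0; rewrite -val_eqE/=; case: ltngtP => // h _.
      by rewrite -natrB 1?ltnW// normr_nat ler1n subn_gt0.
    by rewrite distrC -natrB 1?ltnW// normr_nat ler1n subn_gt0.
  have := gB _ l Fp'; have := gB _ l Fp.
  move: (g _ l) (g _ l) => x y hy hx h.
  have : `|d l| <= `|x - y - d l| + (`|x| + `|y|).
    rewrite -[X in `|X| <= _](subKr (x - y)).
    apply: le_trans (ler_normB _ _) _; rewrite addrC.
    by rewrite lerD// ler_normB.
  by move=> hd; exfalso; lra.
have FC p : F p `<=` cube (r + q%:R * (6 * W)).
  move=> c /Br h i; have := h i; rewrite tnth_mktuple => h2.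
  rewrite -[X in `|X|](addrK (s p i)); apply: le_trans (ler_normB _ _) _.
  apply: lerD => //; apply: le_trans (ler_norm_sum _ _ _) _.
  apply: (@le_trans _ _ (\sum_(j < q) (6 * W)));
    last by rewrite sumr_const card_ord [leRHS]mulr_natl.
  apply: ler_sum => j _; rewrite normrM ler_pM// /t.
  rewrite ger0_norm; last by rewrite mulr_ge0//; lra.
  apply: le_trans N6; rewrite ler_wpM2l//; first lra.
  by rewrite ler_nat ltnW.
have mBoo : lebesgue_tuple k B \is a fin_num.
  rewrite ge0_fin_numE//; apply: le_lt_trans (lebesgue_cube_lty k r).
  by apply: le_measure; rewrite ?inE//; exact: measurable_cube.
pose G (i : 'I_#|{ffun 'I_q -> 'I_N}|) := F (enum_val i).
have tG : trivIset setT G.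
  move=> i j _ _ ij; apply: enum_val_inj; exact: tF.
have E : (lebesgue_tuple k (\big[setU/set0]_i G i) =
  (N ^ q)%:R%:E * lebesgue_tuple k B)%E.
  rewrite (measure_bigsetU_ord _ xpredT)//; last by move=> i; exact: mF.
  rewrite (eq_bigr (fun=> (fine (lebesgue_tuple k B))%:E)); last first.
    by move=> i _; rewrite fineK//; exact: lebesgue_tuple_add.
  rewrite sumEFin sumr_const card_ord card_ffun !card_ord -{2}(fineK mBoo)
    -EFinM.
  by rewrite mulr_natl.
rewrite -E; apply: le_measure; rewrite ?inE.
- by apply: bigsetU_measurable => i _; exact: mF.
- exact: measurable_cube.
- by move=> c; elim/big_ind : _ => [[]|X Y hX hY []//|i _ /FC].
Qed.

Lemma measurable_sublevel k q (g : k.-tuple T -> 'I_q -> R) (r eta : R) :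
  (forall l, measurable_fun setT (fun c => g c l)) ->
  measurable [set c | cube r c /\ forall l, `|g c l| <= eta].
Proof.
move=> mg; set B := [set c | _].
rewrite (_ : B = cube r `&` \bigcap_(l in @setT 'I_q)
  ((fun c => g c l) @^-1` `[- eta, eta])).
  apply: measurableI; first exact: measurable_cube.
  apply: fin_bigcap_measurable => // l _.
  by rewrite -[X in measurable X]setTI; apply: mg => //; exact: measurable_itv.
apply/seteqP; split=> c /= [h1 h2]; split=> // l.
  by move=> _ /=; rewrite in_itv/= -ler_norml.
by have := h2 l I; rewrite /= in_itv/= -ler_norml.
Qed.

(** The hypothesis on [u] says that moving [c] by the combination [t] of the directions [u j] moves
    [g c] by [t], up to a relative error 1/4 in the largest entry. With [N] just above 1 / [eta], at
    least [eta ^- q] disjoint translates of the sublevel set then share a cube whose size does not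
    depend on [eta]. *)
Lemma packing_le k q (g : k.-tuple T -> 'I_q -> R) (u : 'I_q -> 'I_k -> R)
    (r : R) : (forall l, measurable_fun setT (fun c => g c l)) ->
  (forall c (t : 'I_q -> R) l, (forall j, `|t j| <= `|t l|) ->
     `|g (tuple_add (fun i => \sum_j t j * u j i) c) l - g c l - t l|
       <= `|t l| / 4) ->
  forall eta, 0 < eta <= 1 ->
  (lebesgue_tuple k [set c | cube r c /\ forall l, (`|g c l| <= eta)%R] <=
  lebesgue_tuple k (cube (r + q%:R * (6 * \sum_j \sum_i `|u j i|))) *
    (eta ^+ q)%:E)%E.
Proof.
move=> mg gu eta /andP[eta0 eta1].
set B := [set c | _].
have mB : measurable B by exact: measurable_sublevel.
set W := \sum_j _; set N := (Num.truncn eta^-1).+1.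
have Neta : eta^-1 < N%:R by rewrite truncnS_gt.
(* As [N <= 1 / eta + 1] and [eta <= 1], the left side is at most 3 + 3 [eta]. *)
have N6 : 3 * eta * N%:R <= 6.
  have : (Num.truncn eta^-1)%:R <= eta^-1 by rewrite truncn_le// invr_ge0 ltW.
  move=> h; rewrite /N -(natr1 (Num.truncn eta^-1)) mulrDr mulr1.
  suff : eta * (Num.truncn eta^-1)%:R <= 1 by lra.
  by rewrite mulrC -ler_pdivlMr// mul1r.
have uW j i : `|u j i| <= W.
  rewrite /W (bigD1 j)//= (bigD1 i)//= -addrA lerDl addr_ge0// sumr_ge0//.
  by move=> *; rewrite sumr_ge0.
have H := packing_translates mB eta0 (fun c h => h.1) (fun c j h => h.2 j) uW
  gu N6.
rewrite muleC -lee_pdivrMl ?exprn_gt0//.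
apply: le_trans H; rewrite lee_wpmul2r// lee_fin natrX -exprVn.
by rewrite lerXn2r ?nnegrE// ?invr_ge0 ltW.
Qed.
End lebesgue_tuple_theory.

(** * Parameters for which a map vanishes somewhere on a thin set *)

Lemma negligible_small d (X : measurableType d) (R : realType)
    (mu : {measure set X -> \bar R}) (A : set X) :
  (forall e, 0 < e -> exists B, [/\ measurable B, A `<=` B &
    (mu B <= e%:E)%E]) ->
  mu.-negligible A.
Proof.
move=> H.
have /choice[B BP] (i : nat) : exists B, [/\ measurable B, A `<=` B &
    (mu B <= (i.+1%:R^-1)%:E)%E] by apply: H; rewrite invr_gt0.
exists (\bigcap_i B i); split.
- by apply: bigcap_measurable => // i _; case: (BP i).
- apply/eqP; rewrite -measure_le0; apply/lee_addgt0Pr => e e0; rewrite add0e.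
  pose i := Num.truncn e^-1.
  have [mB _ Be] := BP i.
  apply: (@le_trans _ _ (mu (B i))).
    apply: le_measure; rewrite ?inE//; last exact: bigcap_inf.
    by apply: bigcap_measurable => // j _; case: (BP j).
  apply: le_trans Be _; rewrite lee_fin -[leRHS]invrK lef_pV2 ?posrE
    ?invr_gt0//.
  by rewrite ltW// truncnS_gt.
- by move=> x Ax i _; have [_ + _] := BP i; apply.
Qed.

Lemma measure_bigsetU_le d (X : measurableType d) (R : realType)
    (mu : {measure set X -> \bar R}) (I : Type) (s : seq I) (B : I -> set X) :
  (forall i, measurable (B i)) ->
  (mu (\big[setU/set0]_(i <- s) B i) <= \sum_(i <- s) mu (B i))%E.
Proof.
move=> mB; elim: s => [|i s IH]; first by rewrite !big_nil measure0.
rewrite !big_cons; apply: le_trans (leeD _ IH) => //.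
by apply: measureU2 => //; exact: bigsetU_measurable.
Qed.

Section thin.
Context {R : realType} {n : nat}.
Local Notation E := ('rV[R]_n).
Local Notation T := (measurableTypeR R).

(* That is, liminf_{e -> 0} N(e) e^q = 0. *)
Definition thin q (K : set E) := forall d e0 : R, 0 < d -> 0 < e0 ->
  exists e, 0 < e < e0 /\ exists N (c : 'I_N -> E),
    K `<=` \bigcup_(j in setT) box (c j) e /\ N%:R * e ^+ q <= d.

Lemma rV_norm_le (x : E) e : 0 <= e -> (forall i, `|x 0 i| <= e) -> `|x| <= e.
Proof.
move=> e0 h; rewrite [leLHS]/Num.norm/= mx_normrE; apply/bigmax_leP;
  split => //.
by move=> -[i j] _ /=; rewrite ord1.
Qed.

Lemma box_dist (c w w' : E) e : 0 <= e -> box c e w -> box c e w' ->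
  `|w - w'| <= e.
Proof.
move=> e0 bw bw'; apply: rV_norm_le => // i.
have /andP[? ?] := bw i; have /andP[? ?] := bw' i.
by rewrite !mxE ler_norml; apply/andP; split; lra.
Qed.

(* By packing_le, for each of the N boxes of side e covering K, the c in a cube
   for which g c vanishes somewhere in the box have measure O(e^q). *)
Lemma thin_negligible k q (K : set E) (g : k.-tuple T -> E -> 'I_q -> R)
    (u : 'I_q -> 'I_k -> R) :
  (forall w l, K w -> measurable_fun setT (fun c => g c w l)) ->
  (forall w c (t : 'I_q -> R) l, K w -> (forall j, `|t j| <= `|t l|) ->
     `|g (tuple_add (fun i => \sum_j t j * u j i) c) w l - g c w l - t l|
       <= `|t l| / 4) ->
  (forall r, exists L, forall c w w' l, cube r c -> K w -> K w' ->
     `|g c w l - g c w' l| <= L * `|w - w'|) ->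
  thin q K ->
  (lebesgue_tuple k).-negligible
    [set c | exists2 w, K w & forall l, g c w l = 0].
Proof.
move=> mg gu gL thK.
set bad := [set c | _].
(* Countably many cubes exhaust the parameters; finite measure and a uniform Lipschitz constant are
   available on each of them only. *)
suff H (r : nat) : (lebesgue_tuple k).-negligible (cube r%:R `&` bad).
  apply: negligibleS (negligible_bigcup H).
  move=> c bc; pose M := \sum_i `|tnth c i : R|.
  exists (Num.truncn M).+1 => //; split=> // i.
  apply: le_trans (ltW (truncnS_gt M)); rewrite /M (bigD1 i)//= lerDl.
  by rewrite sumr_ge0.
have [L0 gL0] := gL r%:R; pose L := `|L0| + 1.
have L_gt0 : 0 < L by rewrite /L ltr_wpDl.
have gLL c w w' l : cube r%:R c -> K w -> K w' ->
  `|g c w l - g c w' l| <= L * `|w - w'|.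
  move=> hc Kw Kw'; apply: le_trans (gL0 _ _ _ l hc Kw Kw') _;
    rewrite ler_wpM2r//.
  by rewrite /L ler_wpDr// ler_norm.
set C := lebesgue_tuple k (cube (r%:R + q%:R * (6 * \sum_j \sum_i `|u j i|))).
have Cge0 : (0 <= C)%E by exact: measure_ge0.
have Cfin : C \is a fin_num.
  by rewrite ge0_fin_numE//; exact: lebesgue_cube_lty.
have C0 : 0 <= fine C by rewrite fine_ge0.
apply: negligible_small => d d0.
(* The [N] boxes contribute at most [N%:R * C * (L * e) ^+ q] altogether. The bound [e < L^-1]
   required next gives [L * e <= 1], the range of [packing_le]. *)
pose d' := d / (fine C + 1) / L ^+ q.
have d'0 : 0 < d' by rewrite !divr_gt0 ?exprn_gt0// ltr_wpDl.
have [|e [/andP[e0 eL] [N [c [Kc Nd]]]]] := thK d' L^-1 d'0;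
  first by rewrite invr_gt0.
have Le1 : 0 < L * e <= 1.
  by rewrite mulr_gt0//= -ler_pdivlMl// mulr1 ltW.
pose P j w := K w /\ box (c j) e w.
(* [w j] is a point of [K] in the box [j]. If there is none, its value is irrelevant, since [B j] is
   then empty. *)
have /choice[w wP] j : exists y, (exists x, P j x) -> P j y.
  have [[x Px]|h] := pselect (exists x, P j x); first by exists x.
  by exists 0 => /h.
pose B j := [set x | P j (w j) /\
  (cube r%:R x /\ forall l, `|g x (w j) l| <= L * e)].
have mB j : measurable (B j).
  have [Pj|nPj] := pselect (P j (w j)); last first.
    by rewrite (_ : B j = set0)//; apply/seteqP; split=> // x [].
  rewrite (_ : B j = [set x | cube r%:R x /\ forall l,
    `|g x (w j) l| <= L * e]); last first.
    by apply/seteqP; split=> x; [case|].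
  by apply: measurable_sublevel => l; apply: mg; case: Pj.
have muB j : (lebesgue_tuple k (B j) <= C * ((L * e) ^+ q)%:E)%E.
  have [Pj|nPj] := pselect (P j (w j)); last first.
    rewrite (_ : B j = set0); last by apply/seteqP; split=> // x [].
    by rewrite measure0 mule_ge0// lee_fin exprn_ge0// ltW//; case/andP: Le1.
  rewrite (_ : B j = [set x | cube r%:R x /\ forall l,
    `|g x (w j) l| <= L * e]); last first.
    by apply/seteqP; split=> x; [case|].
  apply: packing_le => //; first by move=> l; apply: mg; case: Pj.
  by move=> x t l tl; apply: gu => //; case: Pj.
exists (\big[setU/set0]_(j < N) B j); split.
- exact: bigsetU_measurable.
- move=> x [xr [y Ky gy]]; have [j _ yj] := Kc _ Ky.
  have [Kw wj] : P j (w j) by apply: wP; exists y.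
  rewrite -bigcup_seq/=; exists j => /=; first by rewrite mem_index_enum.
  split=> //; split=> // l; rewrite -[g x _ l]subr0 -(gy l).
  apply: le_trans (gLL _ _ _ _ xr Kw Ky) _; apply: ler_wpM2l; first exact: ltW.
  exact: (box_dist (ltW e0) wj yj).
apply: le_trans (measure_bigsetU_le _ _ mB) _.
apply: (@le_trans _ _ (\sum_(j < N) (C * ((L * e) ^+ q)%:E))%E).
  by apply: lee_sum => j _; exact: muB.
rewrite -(fineK Cfin) -EFinM sumEFin sumr_const card_ord lee_fin -mulr_natl.
rewrite exprMn.
have Lq : 0 < L ^+ q by rewrite exprn_gt0.
have : N%:R * e ^+ q * L ^+ q * (fine C + 1) <= d.
  by rewrite -ler_pdivlMr ?ltr_wpDl// -ler_pdivlMr.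
have : 0 <= N%:R * e ^+ q * L ^+ q by rewrite mulr_ge0 // ?mulr_ge0 //
  exprn_ge0 // ltW.
nra.
Qed.
End thin.

(** * Locally Lipschitz maps *)

Section locally_lipschitz.
Context {R : realType}.

Lemma mx_entry_le_norm p q (A : 'M[R]_(p, q)) i j : `|A i j| <= `|A|.
Proof.
rewrite [leRHS]/Num.norm/= mx_normrE.
by apply/bigmax_geP; right => /=; exists (i, j).
Qed.

Lemma mulmx_entry_le n m (v : 'rV[R]_n) (J : 'M[R]_(n, m)) j :
  `|(v *m J) 0 j| <= n%:R * `|J| * `|v|.
Proof.
rewrite mxE; apply: le_trans (ler_norm_sum _ _ _) _.
apply: (@le_trans _ _ (\sum_(i < n) `|J| * `|v|)); last first.
  by rewrite sumr_const card_ord -mulrA mulr_natl.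
by apply: ler_sum => i _; rewrite normrM mulrC ler_pM// mx_entry_le_norm.
Qed.

Lemma is_diff_coord n m (M : 'M[R]_(n, m)) i j :
  is_diff M (fun A : 'M[R]_(n, m) => A i j : R) (fun A : 'M[R]_(n, m) => A i j).
Proof.
have @f : {linear 'M[R]_(n, m) -> R}.
  by exists (fun N : 'M[R]_(_, _) => N i j); do 2![eexists]; do ?[constructor];
     rewrite ?mxE// => ? *; rewrite ?mxE//; move=> ?; rewrite !mxE.
have cf : continuous f by exact: coord_continuous.
suff : is_diff M f f by [].
by apply: DiffDef; [exact: linear_differentiable|rewrite diff_lin].
Qed.

Definition locally_lipschitz_at (V W : normedModType R) (f : V -> W) (x : V) :=
  exists L, exists2 r, 0 < r & forall y z, ball x r y -> ball x r z ->
    `|f y - f z| <= L * `|y - z|.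

Lemma segment_ball (V : normedModType R) (x y z : V) r t : ball x r y ->
  ball x r z ->
  0 <= t <= 1 -> ball x r (y + t *: (z - y)).
Proof.
rewrite -!ball_normE/= => xy xz /andP[t0 t1].
rewrite (_ : x - _ = (1 - t) *: (x - y) + t *: (x - z)).
  apply: le_lt_trans (ler_normD _ _) _; rewrite !normrZ.
  rewrite (ger0_norm t0) ger0_norm; last by lra.
  (* The strict inequality comes from the second summand, which needs [t > 0]. *)
  have [t0'|t0'] := eqVneq t 0; first by rewrite t0' subr0 mul1r mul0r addr0.
  have tp : 0 < t by rewrite lt_neqAle eq_sym t0' t0.
  have : t * `|x - z| < t * r by rewrite ltr_pM2l.
  have : (1 - t) * `|x - y| <= (1 - t) * r by apply: ler_wpM2l;
    [lra|exact: ltW].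
  lra.
rewrite scalerBl scale1r !scalerBr.
rewrite opprD (opprB (t *: z)) (opprB (t *: x)) -[RHS]addrA [LHS]addrA;
  congr (_ + _).
by rewrite subrKA.
Qed.

(** On a small ball the Jacobian has norm at most [|J x0| + 1]; the mean value theorem is applied to
    each coordinate of [f] along a segment, which stays in the ball by convexity. The factor [n] is
    the price of the max norm on matrices. *)
Lemma C1_on_locally_lipschitz n m (U : set 'rV[R]_n)
    (f : 'rV[R]_n -> 'rV[R]_m) x0 :
  open U -> C1_on U f -> U x0 -> locally_lipschitz_at f x0.
Proof.
move=> oU [df cJf] Ux0.
have [J cJ dJ] : exists2 J : 'rV[R]_n -> 'M[R]_(n, m), {for x0, continuous J} &
    forall x v, U x -> 'd f x v = v *m J x.
  exists (jacobian f); first by move: cJf; rewrite continuous_open_subspace//;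
    apply; rewrite inE.
  by move=> x v Ux; rewrite -deriveE ?deriveEjacobian//; exact: df.
have [r /= r0 rP] : exists2 r : R, 0 < r & forall y, ball x0 r y ->
    U y /\ `|J y| <= `|J x0| + 1.
  have : \forall y \near x0, U y /\ `|J y| <= `|J x0| + 1.
    have A1 : nbhs x0 U by exact: open_nbhs_nbhs.
    have /cvgrPdist_lt/(_ 1 ltr01) A2 := cJ.
    apply: (filterS2 _ _ A1 A2) => y Uy h.
    split=> //; rewrite -[X in `|X|](subKr (J x0)).
    by apply: le_trans (ler_normB _ _) _; rewrite lerD// ltW.
  by move=> /nbhs_ballP[r r0 rP]; exists r.
pose L := n%:R * (`|J x0| + 1).
exists L, r => // y z By Bz.
have L0 : 0 <= L by rewrite mulr_ge0// addr_ge0.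
apply: rV_norm_le => [|j]; first by rewrite mulr_ge0.
pose p (t : R) := y + t *: (z - y).
pose h (t : R) := f (p t) 0 j.
have dp t : is_diff t p ( *:%R ^~ (z - y)).
  have -> : p = cst y + ( *:%R ^~ (z - y)) by [].
  have H : is_diff t (cst y + ( *:%R ^~ (z - y))) (0 + ( *:%R ^~ (z - y))).
    by apply: is_diffD.
  by rewrite add0r in H.
have Up (t : R) : 0 <= t <= 1 -> ball x0 r (p t) by exact: segment_ball.
have dh (t : R) : 0 <= t <= 1 -> is_derive t 1 h (('d f (p t) (z - y)) 0 j).
  move=> t01; have [Upt _] := rP _ (Up t t01).
  have dfp : is_diff (p t) f ('d f (p t)) by apply: differentiableP; exact: df.
  have dcp : is_diff (f (p t)) (fun A : 'rV[R]_m => A 0 j : R) _ :=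
    is_diff_coord _ _ _.
  have dfh : is_diff t ((fun A : 'rV[R]_m => A 0 j) \o (f \o p)) _ :=
    is_diff_comp _ _.
  have [dht hE] := dfh.
  apply: DeriveDef; first exact: diff_derivable.
  by rewrite [LHS](deriveE _ dht) hE /= scale1r.
have [c c01] : exists2 c, c \in `[0, 1]%R & h 1 - h 0 =
  ('d f (p c) (z - y)) 0 j * (1 - 0).
  apply: MVT_segment => //.
    by move=> t; rewrite in_itv/= => /andP[? ?]; apply: dh; rewrite !ltW.
  apply: continuous_in_subspaceT => t; rewrite inE/= in_itv/= => t01.
  apply: differentiable_continuous; apply/derivable1_diffP.
  by have [] := dh t t01.
rewrite subr0 mulr1 /h /p scale0r addr0 scale1r subrKC => E.
move: c01; rewrite in_itv/= => c01.
have [Upc Jc] := rP _ (Up c c01).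
rewrite dJ// in E.
have -> : (f y - f z) 0 j = - ((z - y) *m J (p c)) 0 j.
  by rewrite -E opprB [LHS]mxE; congr (_ + _); rewrite mxE.
rewrite normrN; apply: le_trans (mulmx_entry_le _ _ _) _.
rewrite (distrC z y); apply: ler_wpM2r => //.
by apply: ler_wpM2l.
Qed.

Lemma locally_lipschitz_continuous (V W : normedModType R) (f : V -> W) x :
  locally_lipschitz_at f x -> {for x, continuous f}.
Proof.
move=> [L [r r0 fL]]; apply/cvgrPdist_lt => e e0.
have d0 : 0 < e / (`|L| + 1) by rewrite divr_gt0// ltr_wpDl.
near=> y.
have xy : ball x r y by near: y; exact: nbhsx_ballx.
have xye : ball x (e / (`|L| + 1)) y by near: y; exact: (nbhsx_ballx _ _ d0).
apply: le_lt_trans (fL _ _ (ballxx _ r0) xy) _.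
apply: (@le_lt_trans _ _ ((`|L| + 1) * `|x - y|)).
  by rewrite ler_wpM2r// ler_wpDr// ler_norm.
rewrite -ltr_pdivlMl ?ltr_wpDl// mulrC.
by move: xye; rewrite -ball_normE.
Unshelve. all: by end_near. Qed.

Lemma locally_lipschitz_comp (V W X : normedModType R) (f : V -> W)
  (g : W -> X) x :
  locally_lipschitz_at f x -> locally_lipschitz_at g (f x) ->
  locally_lipschitz_at (g \o f) x.
Proof.
move=> lf; have cf := locally_lipschitz_continuous lf.
move: lf => [L [r r0 fL]] [M [s s0 gM]].
have /nbhs_ballP[r' r'0 fr'] := cf _ (nbhsx_ballx (f x) s s0).
have ballS y : ball x (Num.min r r') y -> ball x r y /\ ball x r' y.
  by rewrite -!ball_normE/= lt_min => /andP[].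
exists (`|M| * L), (Num.min r r'); first by rewrite lt_min r0.
move=> y z /ballS[y1 y2] /ballS[z1 z2] /=.
apply: le_trans (gM _ _ (fr' _ y2) (fr' _ z2)) _.
apply: (@le_trans _ _ (`|M| * `|f y - f z|)).
  by rewrite ler_wpM2r// ler_norm.
by rewrite -mulrA ler_wpM2l// fL.
Qed.

Lemma locally_lipschitz_iter (V : normedModType R) (U : set V)
    (f : V -> V) k x :
  (forall x, U x -> U (f x)) -> (forall x, U x -> locally_lipschitz_at f x) ->
  U x -> locally_lipschitz_at (iter k f) x.
Proof.
move=> fU lf Ux; elim: k => [|k IH].
  by exists 1, 1 => // y z _ _; rewrite mul1r.
apply: (@locally_lipschitz_comp _ _ _ (iter k f) f) => //; apply: lf.
by elim: k {IH} => //= k IH; exact: fU.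
Qed.

End locally_lipschitz.

(** * The probe space *)

(** A probe must be given by independent vectors, whereas the monomials below are indexed by words,
    so that permuted words give the same function. A basis is extracted greedily. *)
Lemma span_basis (R : fieldType) (V : lmodType R) (I : finType) (f : I -> V) :
  exists k (e : 'I_k -> V),
    (forall c : 'I_k -> R, \sum_i c i *: e i = 0 -> forall i, c i = 0) /\
    forall a, exists c : 'I_k -> R, f a = \sum_i c i *: e i.
Proof.
suff [k [e [fe es]]] : exists k (e : 'I_k -> V),
    (forall c : 'I_k -> R, \sum_i c i *: e i = 0 -> forall i, c i = 0) /\
    forall a, a \in enum I -> exists c : 'I_k -> R, f a = \sum_i c i *: e i.
  by exists k, e; split=> // a; apply: es; rewrite mem_enum.
elim: (enum I) => [|a s [k [e [fe es]]]].
  by exists 0%N, (fun=> 0); split=> // c _ [].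
have [[c vc]|nv] := pselect (exists c : 'I_k -> R, f a = \sum_i c i *: e i).
  exists k, e; split=> // x; rewrite inE => /orP[/eqP->|/es//].
  by exists c.
pose e' (i : 'I_k.+1) := if unlift ord0 i is Some j then e j else f a.
have e'S (c : 'I_k.+1 -> R) :
    \sum_i c i *: e' i = c ord0 *: f a + \sum_i c (lift ord0 i) *: e i.
  rewrite big_ord_recl /e' unlift_none; congr (_ + _).
  by apply: eq_bigr => i _; rewrite liftK.
exists k.+1, e'; split=> [c|x].
  rewrite e'S => c0.
  have c00 : c ord0 = 0.
    apply/eqP/negPn/negP => cn0; apply: nv.
    exists (fun i => - (c ord0)^-1 * c (lift ord0 i)).
    under eq_bigr do rewrite -scalerA; rewrite -scaler_sumr.
    move/eqP : c0; rewrite addrC addr_eq0 => /eqP->.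
    by rewrite scaleNr scalerN opprK scalerA mulVf// scale1r.
  move: c0; rewrite c00 scale0r add0r => /fe c0 i.
  by case: (unliftP ord0 i) => [j|] ->.
rewrite inE => /orP[/eqP->|/es[c ->]].
  exists (fun i => (i == ord0)%:R);
    rewrite e'S eqxx scale1r big1 ?addr0// => i _.
  by rewrite eq_sym (negbTE (neq_lift _ _)) scale0r.
exists (fun i => if unlift ord0 i is Some j then c j else 0).
rewrite e'S unlift_none scale0r add0r; apply: eq_bigr => i _.
by rewrite liftK.
Qed.

Section monomials.
Context {R : realType} {n : nat}.
Local Notation E := ('rV[R]_n).

(* Every product of at most D affine functions is a linear combination of the
   monom w. *)
Definition coord_or_one (o : option 'I_n) (x : E) : R :=
  if o is Some i then x 0 i else 1.

Definition monom D (w : {ffun 'I_D -> option 'I_n}) (x : E) : R :=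
  \prod_t coord_or_one (w t) x.

Lemma affine_interpolation (a p : E) : p != a ->
  exists c : option 'I_n -> R, \sum_o c o * coord_or_one o a = 1 /\
    \sum_o c o * coord_or_one o p = 0.
Proof.
move=> pa; have [i pai] : exists i, p 0 i != a 0 i.
  apply/existsP; rewrite -negb_forall; apply: contra pa => /forallP pE.
  by apply/eqP/rowP => i; exact/eqP.
have ne : a 0 i - p 0 i != 0 by rewrite subr_eq0 eq_sym.
(* These are the coefficients of the affine function (x_i - p_i) / (a_i - p_i), where [a] and [p]
   differ in coordinate [i]. *)
exists (fun o => if o is Some j then (j == i)%:R / (a 0 i - p 0 i)
                 else - p 0 i / (a 0 i - p 0 i)).
suff E x : \sum_o (if o is Some j then (j == i)%:R / (a 0 i - p 0 i)
      else - p 0 i / (a 0 i - p 0 i)) * coord_or_one o x =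
        (x 0 i - p 0 i) / (a 0 i - p 0 i).
  by rewrite !E subrr mul0r divff.
rewrite (bigD1 None)//= (bigD1 (Some i))//= big1 ; last first.
  by case=> [j|//] /andP[_]; rewrite (inj_eq Some_inj) => /negbTE->;
    rewrite !mul0r.
by rewrite eqxx /= mulr1n addr0; field.
Qed.

(** Take the product over the points [p] of [s] of affine functions equal to 1 at [a] and 0 at [p],
    fill the remaining of the [D] factors with the constant 1, and expand by distributivity. *)
Lemma monom_interpolation D (s : seq E) (a : E) : a \notin s ->
  (size s <= D)%N ->
  exists c : {ffun 'I_D -> option 'I_n} -> R, \sum_w c w * monom w a = 1 /\
    forall p, p \in s -> \sum_w c w * monom w p = 0.
Proof.
move=> as_ sD.
have /choice[c cP] (t : 'I_D) : exists c : option 'I_n -> R,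
    \sum_o c o * coord_or_one o a = 1 /\
    ((t < size s)%N -> \sum_o c o * coord_or_one o (nth a s t) = 0).
  have [ts|_] := ltnP t (size s); last first.
    exists (fun o => (o == None)%:R); split=> //.
    rewrite (bigD1 None)//= big1 ?eqxx ?mul1r ?addr0// => o /negbTE->.
    by rewrite mul0r.
  have [|c [c1 c2]] := @affine_interpolation a (nth a s t).
    by apply: contra as_ => /eqP <-; exact: mem_nth.
  by exists c.
exists (fun w => \prod_t c t (w t)).
have E x : \sum_(w : {ffun 'I_D -> option 'I_n}) (\prod_t c t (w t)) *
  monom w x =
    \prod_t \sum_o c t o * coord_or_one o x.
  by rewrite bigA_distr_bigA/=; apply: eq_bigr => w _; rewrite big_split.
split=> [|p ps]; rewrite E; first by rewrite big1// => t _; case: (cP t).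
have ts : (index p s < size s)%N by rewrite index_mem.
rewrite (bigD1 (Ordinal (leq_trans ts sD)))//=.
have [_ /(_ ts)] := cP (Ordinal (leq_trans ts sD)).
by rewrite /= nth_index// => ->; rewrite mul0r.
Qed.

Definition C1_scalar (h : E -> R) :=
  (forall x, differentiable h x) /\ forall v,
    continuous (fun x => 'd h x v : R).

Lemma C1_scalar_cst (a : R) : C1_scalar (fun=> a).
Proof.
split=> [x|v]; first exact: differentiable_cst.
rewrite (_ : (fun x => _) = cst 0); first exact: cst_continuous.
by apply/funext => x; rewrite diff_cst.
Qed.

Lemma C1_scalar_coord i : C1_scalar (fun x => x 0 i).
Proof.
split=> [x|v]; first exact: differentiable_coord.
rewrite (_ : (fun x => _) = cst (v 0 i)); first exact: cst_continuous.
apply/funext => x.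
by have [_ h] := is_diff_coord x 0 i; rewrite [X in X v]h.
Qed.

Lemma C1_scalarM (f g : E -> R) : C1_scalar f -> C1_scalar g ->
  C1_scalar (fun x => f x * g x).
Proof.
move=> [df cf] [dg cg]; split=> [x|v]; first exact: differentiableM.
have -> : (fun x => 'd (fun x => f x * g x) x v : R) =
  (fun x => f x * 'd g x v + g x * 'd f x v).
  by apply/funext => x;
    exact: (f_equal (fun L : E -> R => L v) (diffM (df x) (dg x))).
have c h : (forall x, differentiable h x) -> continuous (h : E -> R).
  by move=> dh x; exact: differentiable_continuous.
move=> x; apply: (@continuousD _ _ _ (fun x => f x * 'd g x v)
  (fun x => g x * 'd f x v)).
  by apply: (@continuousM _ _ f (fun x => 'd g x v)); [exact: c|exact: cg].
by apply: (@continuousM _ _ g (fun x => 'd f x v)); [exact: c|exact: cf].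
Qed.

Lemma C1_scalar_monom D (w : {ffun 'I_D -> option 'I_n}) : C1_scalar (monom w).
Proof.
rewrite /monom; elim: (index_enum _) => [|t s IH].
  rewrite (_ : (fun x => _) = (fun=> 1)); first exact: C1_scalar_cst.
  by apply/funext => x; rewrite big_nil.
rewrite (_ : (fun x => _) = (fun x => coord_or_one (w t) x *
    \prod_(t <- s) coord_or_one (w t) x)); last by apply/funext => x;
      rewrite big_cons.
apply: C1_scalarM IH; rewrite /coord_or_one.
by case: (w t) => [i|]; [exact: C1_scalar_coord|exact: C1_scalar_cst].
Qed.

(** Elements of [C1_space] vanish outside [U], so they coincide with a polynomial only near the
    points of [U]; this transfers its derivative to them. *)
Lemma near_eq_differentiable (V W : normedModType R) (f g : V -> W) (x : V) :
  (\forall y \near x, f y = g y) -> differentiable f x ->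
  differentiable g x /\ 'd g x = 'd f x :> (V -> W).
Proof.
move=> fg df; have fgx : f x = g x by exact: (nbhs_singleton fg).
have cd : continuous ('d f x) by exact: diff_continuous.
have H : g \o shift x = cst (g x) + 'd f x +o_ 0 id.
  have /diff_locallyP[_ /eqaddoP fo] := df.
  apply/eqaddoP => e e0; have {}fo := fo e e0.
  have fg0 : \forall h \near 0, f (h + x) = g (h + x).
    have cs : (fun h : V => h + x) @ 0 --> 0 + x.
      by apply: cvgD; [exact: cvg_id|exact: cvg_cst].
    by rewrite add0r in cs; exact: (cs _ fg).
  by apply: (filterS2 _ _ fo fg0) => h; rewrite /= !fctE/= => + fgh;
    rewrite -fgh -fgx.
have E := diff_unique cd H.
by split; [apply/diff_locallyP; rewrite E; split|exact: E].
Qed.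

Lemma continuous_mx_entry (X : topologicalType) p q (F : X -> 'M[R]_(p, q))
  (x : X) :
  (forall i j, {for x, continuous (fun x => F x i j)}) -> {for x, continuous F}.
Proof.
move=> cF; apply/cvgrPdist_le => e e0.
have : \forall y \near x, forall ij : 'I_p * 'I_q,
  `|F x ij.1 ij.2 - F y ij.1 ij.2| <= e.
  apply: filter_forall => -[i j] /=.
  by have /cvgrPdist_le/(_ e e0) := cF i j.
apply: filterS => y h; rewrite [leLHS]/Num.norm/= mx_normrE; apply/bigmax_leP.
by split=> [|ij _]; [exact: ltW|rewrite !mxE; exact: h].
Qed.

End monomials.

Section probe.
Context {R : realType} {n m : nat} (U : set 'rV[R]_n) (openU : open U).
Local Notation E := ('rV[R]_n).
Local Notation V := (C1_space U m).

Lemma C1_spaceZDE (a : R) (f g : V) x : (a *: f + g) x = a *: f x + g x.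
Proof. by []. Qed.

Lemma C1_space_sumE (I : finType) (c : I -> R) (f : I -> V) x j :
  (\sum_i c i *: f i) x 0 j = \sum_i c i * f i x 0 j.
Proof.
elim/big_rec2: _ => [|i y1 y2 _ <-]; first by rewrite [LHS]mxE.
by rewrite C1_spaceZDE !mxE.
Qed.

Definition scalar_extension (h : E -> R) (v : 'rV[R]_m) (x : E) : 'rV[R]_m :=
  if `[< U x >] then h x *: v else 0.

Lemma scalar_extension_C1 h v : C1_scalar h ->
  scalar_extension h v \in @C1_pred R n U m.
Proof.
move=> [dh ch]; rewrite inE; split; last first.
  by move=> x nUx; rewrite /scalar_extension; case: asboolP.
have nearE x : U x -> \forall y \near x, h y *: v = scalar_extension h v y.
  move=> Ux; have : nbhs x U by exact: open_nbhs_nbhs.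
  by apply: filterS => y Uy; rewrite /scalar_extension; case: asboolP.
have dE x : U x -> differentiable (scalar_extension h v) x /\
    'd (scalar_extension h v) x = (fun w => 'd h x w *: v) :> (E -> _).
  move=> Ux; have dhv : differentiable (fun z => h z *: v) x
    by exact: differentiableZl.
  have [d1 d2] := near_eq_differentiable (nearE x Ux) dhv.
  by split; [exact: d1|rewrite d2; exact: (diffZl v (dh x))].
split=> [x /dE[]//|].
pose J x : 'M[R]_(n, m) := \matrix_(i, j) ('d h x (delta_mx 0 i) * v 0 j).
apply: (@subspace_eq_continuous _ U _ J) => [x /set_mem Ux|].
  apply/matrixP => i j; rewrite mxE /jacobian /lin1_mx mxE.
  by have [_ ->] := dE x Ux; rewrite mxE.
apply: continuous_subspaceT => x; apply: continuous_mx_entry => i j.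
rewrite (_ : (fun x => J x i j) = (fun x => 'd h x (delta_mx 0 i) * v 0 j));
  last first.
  by apply/funext => y; rewrite mxE.
by apply: (@continuousM _ _ (fun x => 'd h x (delta_mx 0 i)) (fun=> v 0 j));
  [exact: ch|exact: cst_continuous].
Qed.

(** The vectors [e] are chosen before the points: a single probe interpolates at any [a] and any
    list of at most [D] other points of [U]. *)
Lemma exists_probe (j0 : 'I_m) D : exists k (e : 'I_k -> V),
  (forall c : 'I_k -> R, \sum_i c i *: e i = 0 -> forall i, c i = 0) /\
  forall (a : E) (s : seq E), U a -> (forall p, p \in s -> U p) -> a \notin s ->
    (size s <= D)%N ->
    exists u : 'I_k -> R, \sum_i u i * e i a 0 j0 = 1 /\
      forall p, p \in s -> \sum_i u i * e i p 0 j0 = 0.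
Proof.
pose f (w : {ffun 'I_D -> option 'I_n}) : V :=
  MkC1 (scalar_extension_C1 (delta_mx 0 j0) (C1_scalar_monom w)).
have fE w x : U x -> f w x 0 j0 = monom w x.
  rewrite /= /scalar_extension; case: asboolP => // _ _.
  by rewrite !mxE !eqxx mulr1.
have [k [e [fe es]]] := span_basis f.
exists k, e; split=> // a s Ua Us as_ sD.
have [c [ca cs]] := monom_interpolation as_ sD.
have /choice[b bP] w : exists b : 'I_k -> R, f w = \sum_i b i *: e i.
  exact: es.
have H p : U p -> \sum_i (\sum_w c w * b w i) * e i p 0 j0 =
  \sum_w c w * monom w p.
  move=> Up; under eq_bigr do rewrite big_distrl/=.
  rewrite exchange_big/=; apply: eq_bigr => w _.
  rewrite -(fE w p Up) bP C1_space_sumE big_distrr/=.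
  by apply: eq_bigr => i _; rewrite mulrA.
exists (fun i => \sum_w c w * b w i); split=> [|p ps]; rewrite H//.
  exact: cs.
exact: Us.
Qed.

End probe.

(** * Separation of delay coordinates *)

(** If [P K] failed, the sets [B] with [P (K minus B)] would form a proper filter containing [K]. At
    a cluster point of it in [K], a neighbourhood [V] with [P (V]&[K)] would have to meet its own
    complement. *)
Lemma compact_induction (X : topologicalType) (P : set X -> Prop) (K : set X) :
  compact K -> P set0 -> (forall A B, A `<=` B -> P B -> P A) ->
  (forall A B, P A -> P B -> P (A `|` B)) ->
  (forall x, K x -> exists2 V, nbhs x V & P (V `&` K)) -> P K.
Proof.
move=> cK P0 PS PU Ploc; apply: contrapT => nPK.
pose F : set_system X := fun B => P (K `\` B).
have FF : Filter F.
  split; rewrite /F.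
  - by rewrite setDT.
  - by move=> A B FA FB; rewrite setDIr; exact: PU.
  - by move=> A B AB; apply: PS; exact: setDS.
have PF : ProperFilter F by split=> //; rewrite /F setD0.
have [|x [Kx clx]] := cK F PF.
  by rewrite /F setDv.
have [V Vx PV] := Ploc x Kx.
have /(_ (~` V) V)[] // : cluster F x by [].
  by rewrite /F setDE setCK setIC.
by move=> y [].
Qed.

Section separation.
Context {R : realType} {n m : nat} (U : set 'rV[R]_n).
Local Notation E := ('rV[R]_n).
Local Notation V := (C1_space U m).
Context (S : E -> E) (SU : forall x, U x -> U (S x))
  (lS : forall x, U x -> locally_lipschitz_at S x) (openU : open U) (j0 : 'I_m).

Definition separating q (K : set E) (z : E) : set V :=
  [set Y : V | forall w, K w -> exists l : 'I_q,
    Y (iter l S w) 0 j0 <> Y (iter l S z) 0 j0].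

Lemma iter_U l x : U x -> U (iter l S x).
Proof. by move=> Ux; elim: l => //= l; exact: SU. Qed.

Lemma locally_lipschitz_eval (Y : V) l x : U x ->
  locally_lipschitz_at (fun w => Y (iter l S w) 0 j0 : R) x.
Proof.
move=> Ux; have CY : C1_on U Y by have := C1_funP Y; rewrite inE => -[].
have := locally_lipschitz_comp (locally_lipschitz_iter l SU lS Ux)
  (C1_on_locally_lipschitz openU CY (iter_U l Ux)).
move=> [L [r r0 h]]; exists L, r => // y y' By By'.
apply: le_trans (h _ _ By By').
by apply: le_trans (mx_entry_le_norm _ 0 j0); rewrite !mxE.
Qed.

Lemma continuous_iter l x : U x -> {for x, continuous (iter l S)}.
Proof.
by move=> Ux; apply: locally_lipschitz_continuous;
  exact: locally_lipschitz_iter Ux.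
Qed.

Lemma compact_iter l (K : set E) : compact K -> K `<=` U ->
  compact (iter l S @` K).
Proof.
move=> cK KU; apply: continuous_compact cK.
apply: continuous_in_subspaceT => x /set_mem/KU; exact: continuous_iter.
Qed.

(** By compactness some margin [e] works for all [w] in [K]. It survives perturbing [Y] by less than
    [e / 2] on the compact sets S^l(K) and at the points S^l z. *)
Lemma open_separating q (K : set E) z : compact K -> K `<=` U -> U z ->
  open (separating q K z).
Proof.
move=> cK KU Uz; rewrite openE => Y sY.
have [e e0 sYe] : exists2 e, 0 < e & forall w, K w -> exists l : 'I_q,
    e <= `|Y (iter l S w) 0 j0 - Y (iter l S z) 0 j0|.
  apply: (@compact_induction _
    (fun K => exists2 e, 0 < e & forall w, K w -> exists l : 'I_q,
    e <= `|Y (iter l S w) 0 j0 - Y (iter l S z) 0 j0|)) => //.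
  - by exists 1.
  - by move=> A B AB [e e0 h]; exists e => // w /AB/h.
  - move=> A B [e e0 h] [e' e'0 h']; exists (Num.min e e');
      first by rewrite lt_min e0.
    by move=> w [/h|/h'] [l wl]; exists l; apply: le_trans wl;
      rewrite ge_min lexx ?orbT.
  - move=> w /[dup] Kw /KU Uw; have [l Yl] := sY w Kw.
    pose a := `|Y (iter l S w) 0 j0 - Y (iter l S z) 0 j0|.
    have a0 : 0 < a by rewrite normr_gt0 subr_eq0; exact/eqP.
    have /cvgrPdist_lt/(_ (a / 2)) H :=
      locally_lipschitz_continuous (locally_lipschitz_eval Y l Uw).
    have a20 : 0 < a / 2 by rewrite divr_gt0.
    exists [set y | `|Y (iter l S w) 0 j0 - Y (iter l S y) 0 j0| < a / 2];
      first exact: H.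
    exists (a / 2) => // y [/= ya _]; exists l.
    have : a <= `|Y (iter l S w) 0 j0 - Y (iter l S y) 0 j0| + `|Y (iter l S y)
      0 j0 - Y (iter l S z) 0 j0|.
      by apply: le_trans (ler_normD _ _); rewrite subrKA.
    by move=> h; lra.
have H (K' : set E) : compact K' -> K' `<=` U ->
    \forall Y' \near Y, forall x, K' x ->
      `|Y x 0 j0 - C1_fun Y' x 0 j0| < e / 2.
  move=> cK' K'U; have e20 : 0 < e / 2 by rewrite divr_gt0.
  have := (C1_cvgP Y (nbhs_filter Y)).1 cvg_id K' _ cK' K'U e20.
  apply: filterS => Y' h x K'x; have [h1 _] := h x K'x.
  apply: le_lt_trans h1.
  by apply: le_trans (mx_entry_le_norm _ 0 j0); rewrite !mxE.
have H1 : \forall Y' \near Y, forall l : 'I_q, forall x, (iter l S @` K) x ->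
    `|Y x 0 j0 - C1_fun Y' x 0 j0| < e / 2.
  apply: (@filter_forall _ _ _ _ (nbhs_filter Y)) => l;
    apply: (H _ (@compact_iter l K cK KU)).
  by move=> _ [x /KU Ux <-]; exact: iter_U.
have H2 : \forall Y' \near Y, forall l : 'I_q, forall x, [set iter l S z] x ->
    `|Y x 0 j0 - C1_fun Y' x 0 j0| < e / 2.
  apply: (@filter_forall _ _ _ _ (nbhs_filter Y)) => l;
    apply: (H _ (@compact_set1 _ (iter l S z))).
  by move=> _ ->; exact: iter_U.
apply: (filterS2 _ _ H1 H2) => Y' h1 h2 w Kw.
have [l wl] := sYe w Kw; exists l => Y'wz.
have {}h1 := h1 l _ (ex_intro2 _ _ w Kw erefl).
have {}h2 := h2 l _ erefl.
suff : `|Y (iter l S w) 0 j0 - Y (iter l S z) 0 j0| < e by lra.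
rewrite (_ : _ - _ = (Y (iter l S w) 0 j0 - Y' (iter l S w) 0 j0) -
  (Y (iter l S z) 0 j0 - Y' (iter l S z) 0 j0)).
  by apply: le_lt_trans (ler_normB _ _) _; lra.
rewrite Y'wz; ring.
Qed.
End separation.

Section probe_separation.
Context {R : realType} {n m : nat} (U : set 'rV[R]_n).
Local Notation E := ('rV[R]_n).
Local Notation V := (C1_space U m).
Context (S : E -> E) (SU : forall x, U x -> U (S x))
  (lS : forall x, U x -> locally_lipschitz_at S x) (openU : open U) (j0 : 'I_m).
Context (D k : nat) (e : 'I_k -> V)
  (eP : forall (a : E) (s : seq E), U a -> (forall p, p \in s -> U p) ->
    a \notin s -> (size s <= D)%N ->
    exists u : 'I_k -> R, \sum_i u i * e i a 0 j0 = 1 /\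
      forall p, p \in s -> \sum_i u i * e i p 0 j0 = 0).

Local Notation coords := (k.-tuple (measurableTypeR R)).

Definition probe_shift (v : V) (c : coords) : V :=
  v + \sum_i (tnth c i : R) *: e i.

Let dif (Y : V) l w z : R := Y (iter l S w) 0 j0 - Y (iter l S z) 0 j0.

Lemma dif_probe_shift v c l w z :
  dif (probe_shift v c) l w z =
    dif v l w z + \sum_i (tnth c i : R) * dif (e i) l w z.
Proof.
rewrite /dif /probe_shift.
have E x : (v + \sum_i (tnth c i : R) *: e i) x 0 j0 =
    v x 0 j0 + \sum_i (tnth c i : R) * e i x 0 j0.
  by rewrite -[in LHS](scale1r v) C1_spaceZDE scale1r mxE C1_space_sumE.
rewrite !E opprD addrACA; congr (_ + _).
by rewrite -sumrB; apply: eq_bigr => i _; rewrite mulrBr.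
Qed.

(** Near a given [w0], interpolation yields probe directions [u j] along which the [q] differences
    of delay coordinates move almost independently, so that [thin_negligible] applies. Compactness
    passes from neighbourhoods to [K]. *)
Lemma negligible_probe_shift q (K : set E) z v :
  (q.*2 <= D)%N -> compact K -> K `<=` U -> U z -> thin q K ->
  (forall w a b, K w -> (a < q)%N -> (b < q)%N -> iter a S w = iter b S w ->
    a = b) ->
  (forall w a b, K w -> (a < q)%N -> (b < q)%N -> iter a S w <> iter b S z) ->
  {ae lebesgue_tuple k, forall c, separating S j0 q K z (probe_shift v c)}.
Proof.
move=> qD cK KU Uz thK inj_w disj.
pose P (B : set E) := (lebesgue_tuple k).-negligible
  [set c | exists2 w, B w & forall l : 'I_q, dif (probe_shift v c) l w z = 0].
suff : P K.
  apply: negligibleS => c /=; rewrite -existsNP => -[w /not_implyP[Kw nl]].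
  exists w => // l; apply/eqP; rewrite subr_eq0; apply/eqP;
    apply: contrapT => h.
  by apply: nl; exists l.
apply: (compact_induction cK).
- by apply: negligibleS (@negligible_set0 _ _ _ _) => c [].
- by move=> A B AB; apply: negligibleS => c [w /AB Bw h]; exists w.
- move=> A B PA PB; apply: negligibleS (negligibleU PA PB) => c [w [Aw|Bw] h].
    by left; exists w.
  by right; exists w.
move=> w0 Kw0; have Uw0 := KU _ Kw0.
have /choice[u uP] (j : 'I_q) : exists u : 'I_k -> R, forall l : 'I_q,
    \sum_i u i * dif (e i) l w0 z = (j == l)%:R.
  (* All points where the direction [u j] has to vanish, while being 1 at S^j w0. The points S^l z
     may coincide with each other; the list has at most 2q entries. *)
  pose s := [seq iter (val l) S w0 | l <- enum 'I_q & l != j] ++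
    [seq iter (val l) S z | l : 'I_q].
  have [||||u [uj us]] := @eP (iter j S w0) s.
  - exact: iter_U.
  - by move=> p; rewrite mem_cat => /orP[/mapP[l _ ->]|/mapP[l _ ->]];
      exact: iter_U.
  - rewrite mem_cat negb_or; apply/andP; split; apply/mapP => -[l].
      by rewrite mem_filter => /andP[lj _]
        /(inj_w _ _ _ Kw0 (ltn_ord j) (ltn_ord l)) /val_inj jl;
        rewrite jl eqxx in lj.
    by move=> _; exact: (disj _ _ _ Kw0 (ltn_ord j) (ltn_ord l)).
  - rewrite size_cat !size_map -enumT size_enum_ord; apply: leq_trans qD.
    by rewrite -addnn leq_add2r size_filter;
      apply: leq_trans (count_size _ _) _; rewrite size_enum_ord.
  exists u => l; rewrite /dif; under eq_bigr do rewrite mulrBr.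
  rewrite sumrB [X in _ - X]us ?subr0; last first.
    by rewrite mem_cat; apply/orP; right; apply/mapP; exists l;
      rewrite ?mem_enum.
  have [<-|jl] := eqVneq j l; first by rewrite uj.
  rewrite us// mem_cat; apply/orP; left; apply/mapP.
  by exists l => //; rewrite mem_filter eq_sym jl mem_enum.
(* [v] and the vectors of the probe are indexed together in order to get one Lipschitz constant and
   one neighbourhood for all of them. *)
pose phi (o : option 'I_k) (l : 'I_q) (w : E) : R :=
  (if o is Some i then e i else v) (iter l S w) 0 j0.
have /choice[Lr LP] (ol : option 'I_k * 'I_q) : exists Lr : R * R, 0 < Lr.2 /\
    forall y y', ball w0 Lr.2 y -> ball w0 Lr.2 y' ->
      `|phi ol.1 ol.2 y - phi ol.1 ol.2 y'| <= Lr.1 * `|y - y'|.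
  have [L [r r0 h]] := locally_lipschitz_eval SU lS openU j0
    (if ol.1 is Some i then e i else v) ol.2 Uw0.
  by exists (L, r).
pose M := \sum_ol `|(Lr ol).1|.
have M0 : 0 <= M by rewrite sumr_ge0.
have N1 : \forall y \near w0, forall ol, ball w0 (Lr ol).2 y.
  by apply: (@filter_forall E (option 'I_k * 'I_q)%type _ _ (nbhs_filter w0))
    => ol; apply: nbhsx_ballx; case: (LP ol).
have q1 : 0 < 4 * q.+1%:R :> R by rewrite mulr_gt0.
(* The [q] errors of this size add up to at most 1/4, as [thin_negligible] requires; [q.+1] keeps
   the denominator nonzero. *)
have N2 : \forall y \near w0, forall jl : 'I_q * 'I_q,
    `|\sum_i u jl.1 i * dif (e i) jl.2 y z - (jl.1 == jl.2)%:R| <=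
      (4 * q.+1%:R)^-1.
  apply: (@filter_forall E ('I_q * 'I_q)%type _ _ (nbhs_filter w0)) =>
    -[j l] /=.
  have c : {for w0, continuous (fun y => \sum_i u j i * dif (e i) l y z)}.
    elim: (index_enum _) => [|i s IH].
      rewrite (_ : (fun y => _) = (fun=> 0)); first exact: cst_continuous.
      by apply/funext => y; rewrite big_nil.
    have -> : (fun y => \sum_(i <- i :: s) u j i * dif (e i) l y z) =
        (fun y => u j i * dif (e i) l y z + \sum_(i <- s) u j i * dif (e i) l y
          z).
      by apply/funext => y; rewrite big_cons.
    apply: (@continuousD _ _ _ (fun y => u j i * dif (e i) l y z)) IH.
    apply: (@continuousM _ _ (fun=> u j i) (fun y => dif (e i) l y z));
      first exact: cst_continuous.
    apply: (@continuousB _ _ _ (fun y => e i (iter l S y) 0 j0 : R) (fun=> _));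
      last exact: cst_continuous.
    exact: (locally_lipschitz_continuous
      (locally_lipschitz_eval SU lS openU j0 (e i) l Uw0)).
  have /cvgrPdist_le/(_ (4 * q.+1%:R)^-1) := c.
  rewrite invr_gt0 => /(_ q1); apply: filterS => y.
  by rewrite uP distrC.
exists [set y | (forall ol, ball w0 (Lr ol).2 y) /\ forall jl : 'I_q * 'I_q,
    `|\sum_i u jl.1 i * dif (e i) jl.2 y z - (jl.1 == jl.2)%:R| <=
      (4 * q.+1%:R)^-1].
  exact: filterI N1 N2.
apply: (@thin_negligible _ _ k q _
  (fun c w (l : 'I_q) => dif (probe_shift v c) l w z) u).
- move=> w l _; apply: (eq_measurable_fun (fun c : coords =>
    dif v l w z + \sum_i (tnth c i : R) * dif (e i) l w z)).
    by move=> c _; rewrite dif_probe_shift.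
  apply: measurable_funD => //; apply: measurable_sum => i.
  by apply: measurable_funM => //; exact: measurable_tnth.
- move=> w c t l [[_ wN2] _] tl; rewrite !dif_probe_shift.
  have -> : dif v l w z + \sum_i
    (tnth (tuple_add (fun i => \sum_j t j * u j i) c) i : R) * dif (e i) l w z
      - (dif v l w z + \sum_i (tnth c i : R) * dif (e i) l w z) - t l =
      \sum_j t j * (\sum_i u j i * dif (e i) l w z - (j == l)%:R).
    rewrite opprD addrACA subrr add0r -sumrB.
    under eq_bigr do rewrite tnth_mktuple -mulrBl addrAC subrr add0r
      big_distrl/=.
    rewrite exchange_big/=.
    under [RHS]eq_bigr do rewrite mulrBr big_distrr/=.
    rewrite sumrB; congr (_ - _).
      by apply: eq_bigr => j _; apply: eq_bigr => i _; rewrite mulrA.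
    rewrite (bigD1 l)//= eqxx mulr1 big1 ?addr0// => j /negbTE->.
    by rewrite mulr0.
  apply: le_trans (ler_norm_sum _ _ _) _.
  apply: (@le_trans _ _ (\sum_(j < q) (`|t l| * (4 * q.+1%:R)^-1))).
    apply: ler_sum => j _; rewrite normrM ler_pM//.
    exact: (wN2 (j, l)).
  rewrite sumr_const card_ord -[leLHS]mulr_natr -mulrA ler_wpM2l//.
  rewrite mulrC ler_pdivrMr// mulrA mulVf// mul1r.
  by rewrite ler_nat.
- move=> r; exists (M + k%:R * (r * M)) => c w w' l cr [[wN1 _] _] [[w'N1 _] _].
  rewrite !dif_probe_shift.
  have PL o : `|phi o l w - phi o l w'| <= M * `|w - w'|.
    apply: le_trans ((LP (o, l)).2 _ _ (wN1 _) (w'N1 _)) _.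
    apply: ler_wpM2r => //; rewrite /M (bigD1 (o, l))//=.
    by apply: le_trans (ler_norm _) _; rewrite lerDl sumr_ge0.
  have -> : dif v l w z + \sum_i (tnth c i : R) * dif (e i) l w z
      - (dif v l w' z + \sum_i (tnth c i : R) * dif (e i) l w' z) =
      (phi None l w - phi None l w') + \sum_i (tnth c i : R) *
        (phi (Some i) l w - phi (Some i) l w').
    rewrite opprD addrACA -sumrB; congr (_ + _); first by rewrite /dif /phi;
      ring.
    by apply: eq_bigr => i _; rewrite /dif /phi; ring.
  rewrite mulrDl; apply: le_trans (ler_normD _ _) _; apply: lerD;
    first exact: PL.
  apply: le_trans (ler_norm_sum _ _ _) _.
  apply: (@le_trans _ _ (\sum_(i < k) (r * M * `|w - w'|))).
    apply: ler_sum => i _; rewrite normrM -mulrA ler_pM//.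
  by rewrite sumr_const card_ord -[leLHS]mulr_natl !mulrA.
- move=> d e0 d0 e00; have [x [x0 [N0 [b [bK bd]]]]] := thK d e0 d0 e00.
  by exists x; split=> //; exists N0, b; split=> // y [_ /bK].
Qed.
End probe_separation.

(** * Box dimension *)

Section box_dimension.
Context {R : realType} {n : nat}.
Local Notation E := ('rV[R]_n).

Lemma thin_subset q (A B : set E) : A `<=` B -> thin q B -> thin q A.
Proof.
move=> AB thB d e0 d0 e00; have [e [e1 [k [c [Bc kd]]]]] := thB d e0 d0 e00.
by exists e; split=> //; exists k, c; split=> // x /AB/Bc.
Qed.

Lemma thin_subsingleton (A : set E) :
  (forall x y, A x -> A y -> x = y) -> thin 1 A.
Proof.
move=> A1 d e0 d_gt0 e0_gt0; pose e := Num.min d e0 / 2.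
have m0 : 0 < Num.min d e0 by rewrite lt_min d_gt0.
have me : Num.min d e0 <= e0 by rewrite ge_min lexx orbT.
have md : Num.min d e0 <= d by rewrite ge_min lexx.
exists e; split; first by rewrite /e; apply/andP; split; lra.
exists 1%N.
have [[x Ax]|nA] := pselect (exists x, A x).
  exists (fun=> x); split; last by rewrite /e expr1 mul1r; lra.
  move=> y Ay; exists ord0 => // i; rewrite (A1 _ _ Ay Ax) lexx/=.
  by rewrite lerDl /e; lra.
exists (fun=> 0); split; last by rewrite /e expr1 mul1r; lra.
by move=> y Ay; exfalso; apply: nA; exists y.
Qed.

Lemma compact_box_cover (A : set E) (e : R) : compact A -> 0 < e ->
  exists k (c : 'I_k -> E), A `<=` \bigcup_(j in setT) box (c j) e.
Proof.
move=> cA e0; apply: (compact_induction (P := fun A => exists k (c : 'I_k -> E),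
    A `<=` \bigcup_(j in setT) box (c j) e) cA).
- by exists 0%N, (fun=> 0) => x [].
- by move=> B C BC [k [c Cc]]; exists k, c => x /BC/Cc.
- move=> B C [k [b Bb]] [l [c Cc]].
  exists (k + l)%N, (fun j : 'I_(k + l) => match fintype.split j with inl i =>
    b i | inr i => c i end).
  move=> x [/Bb|/Cc] [j _ jx].
    by exists (lshift l j) => //;
      rewrite -[lshift l j]/(unsplit (inl j)) unsplitK.
  by exists (rshift k j) => //;
    rewrite -[rshift k j]/(unsplit (inr j)) unsplitK.
- move=> x _; exists (ball x (e / 2)); first by apply: nbhsx_ballx;
    rewrite divr_gt0.
  (* With this corner the box is the closed ball of radius [e / 2] around [x]. *)
  exists 1%N, (fun=> \row_i (x 0 i - e / 2)) => y [xy _]; exists ord0 => // i.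
  have : `|x 0 i - y 0 i| < e / 2.
    move: xy; rewrite -ball_normE/=; apply: le_lt_trans.
    by apply: le_trans (mx_entry_le_norm _ 0 i); rewrite !mxE.
  by rewrite mxE ltr_norml => /andP[h1 h2]; apply/andP; split; lra.
Qed.

(** Compactness makes the set under the infimum nonempty, which rules out the default value of
    [inf]; a cover within 1 of the infimum is precise enough for the dimension. *)
Lemma box_number_cover (A : set E) (e : R) : compact A -> 0 < e ->
  exists k (c : 'I_k -> E), A `<=` \bigcup_(j in setT) box (c j) e /\
    k%:R < box_number A e + 1.
Proof.
move=> cA e0; have [k [c Ac]] := compact_box_cover cA e0.
have [|x [l [b Ab] <-] lx] := @inf_adherent R
  [set k%:R | k in [set k : nat |
    exists c : 'I_k -> E, A `<=` \bigcup_(j in setT) box (c j) e]] 1 ltr01.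
  split; first by exists k%:R, k => //; exists c.
  by exists 0 => _ [l _ <-].
by exists l, b.
Qed.

(** For d < d1 < q and small e the number of boxes is at most 2 e^(-d1), and 2 e^(q - d1) tends to
    0. *)
Lemma boxdim_thin (A : set E) d q : compact A -> has_boxdim A d ->
  (0 < q)%N -> d < q%:R -> thin q A.
Proof.
move=> cA dimA q0 dq de e0 de0 e00.
have q0' : 0 < q%:R :> R by rewrite ltr0n.
(* The maximum with 0 ensures [d1 > 0], so that e^(-d1) >= 1 absorbs the 1 lost in
   [box_number_cover]. *)
pose d1 := (Num.max d 0 + q%:R) / 2.
have m1 : d <= Num.max d 0 by rewrite le_max lexx.
have m2 : 0 <= Num.max d 0 by rewrite le_max lexx orbT.
have m3 : Num.max d 0 < q%:R by rewrite gt_max dq.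
have dd1 : d < d1 by rewrite /d1; lra.
have d10 : 0 < d1 by rewrite /d1; lra.
have d1q : d1 < q%:R by rewrite /d1; lra.
(* 2 e^(q - d1) is at most [de] as soon as ln (1 / e) exceeds [X]. *)
pose X := `|ln (de / 2)| / (q%:R - d1).
have near1 : \forall e \near 0^'+, ln (box_number A e) / ln e^-1 < d1.
  by apply: (cvgr_lt d).
have near2 : \forall e \near 0^'+, e < Num.min (Num.min 1 e0) (expR (- X)).
  by apply: nbhs_right_lt; rewrite !lt_min ltr01 e00 expR_gt0.
have near3 := nbhs_right_gt (0 : R).
have [e [[h1 h2] h3]] := @filter_ex _ _ (at_right_proper_filter (0 : R)) _
  (filterI (filterI near1 near2) near3).
move: h2; rewrite !lt_min => /andP[/andP[e1 ee0] eX].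
exists e; split; first by rewrite h3.
have [k [c [Ac kN]]] := box_number_cover cA h3.
exists k, c; split=> //.
pose t := ln e^-1.
have tE : t = - ln e by rewrite /t lnV.
have t0 : 0 < t by rewrite tE oppr_gt0 ln_lt0// h3.
have tX : X < t.
  by rewrite tE ltrNr -(expRK (- X)) ltr_ln ?posrE ?expR_gt0.
have Nt : box_number A e <= expR (d1 * t).
  have [N0|N0] := leP (box_number A e) 0.
    by apply: le_trans N0 _; exact: expR_ge0.
  by rewrite -[leLHS]lnK// ler_expR -ler_pdivrMr// ltW.
have k2 : k%:R <= 2 * expR (d1 * t).
  have : 1 <= expR (d1 * t) by rewrite -expR0 ler_expR mulr_ge0// ltW.
  by lra.
have eq : e ^+ q = expR (- (q%:R * t)).
  by rewrite -mulrN tE opprK expRM_natl lnK.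
rewrite eq; apply: (@le_trans _ _ (2 * expR (d1 * t) * expR (- (q%:R * t)))).
  by rewrite ler_wpM2r// expR_ge0.
rewrite -mulrA -expRD -ler_pdivlMl// [leRHS]mulrC.
have -> : d1 * t - q%:R * t = - ((q%:R - d1) * t) by ring.
rewrite -[leRHS]lnK ?posrE ?divr_gt0// ler_expR.
have : `|ln (de / 2)| <= (q%:R - d1) * t.
  by rewrite [leRHS]mulrC -ler_pdivrMr ?subr_gt0//; exact: ltW.
have := ler_norm (- ln (de / 2)); rewrite normrN; lra.
Qed.

Lemma boxdim_ge0 (A : set E) d x : A x -> has_boxdim A d -> 0 <= d.
Proof.
move=> Ax dimA; rewrite leNgt; apply/negP => d0.
have near1 : \forall e \near 0^'+, ln (box_number A e) / ln e^-1 < 0.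
  by apply: (cvgr_lt d).
have near2 : \forall e \near 0^'+, (e : R) < 1 by exact: nbhs_right_lt.
have near3 := nbhs_right_gt (0 : R).
have [e [[/= h1 h2] h3]] := @filter_ex _ _ (at_right_proper_filter (0 : R)) _
  (filterI (filterI near1 near2) near3).
have : 0 <= ln (box_number A e) / ln e^-1.
  apply: divr_ge0; last by rewrite ln_ge0// invf_ge1// ltW.
  pose C := [set k%:R | k in [set k : nat |
    exists c : 'I_k -> E, A `<=` \bigcup_(j in setT) box (c j) e]] : set R.
  have [C0|C0] := pselect (nonempty C).
    apply: ln_ge0; apply: lb_le_inf => // _ [[|k] [c Ac] <-];
      last by rewrite ler1n.
    by have [[]] := Ac x Ax.
  (* If no finite cover exists, the infimum is 0 by default and [ln 0 = 0]. *)
  rewrite (_ : box_number A e = 0).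
    by rewrite ln0.
  by apply: inf_out => -[].
by move=> h; move: h1; rewrite ltNge h.
Qed.

End box_dimension.

(** * Supports and basins *)

Lemma open_preimage_on (X Y : topologicalType) (U : set X) (f : X -> Y)
  (B : set Y) :
  open U -> (forall x, U x -> {for x, continuous f}) -> open B ->
  open (U `&` f @^-1` B).
Proof.
move=> oU cf oB; rewrite openE => x [Ux Bfx].
have h1 : nbhs x U by exact: open_nbhs_nbhs.
have h2 : nbhs x (f @^-1` B) by apply: (cf x Ux); exact: open_nbhs_nbhs.
exact: filterI h1 h2.
Qed.

Section support.
Context {R : realType} {n : nat} (mu : probability (borel 'rV[R]_n) R).
Local Notation E := ('rV[R]_n).

Lemma borel_open k (B : set 'rV[R]_k) : open B ->
  measurable (B : set (borel 'rV[R]_k)).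
Proof. by move=> oB; exact: sub_sigma_algebra. Qed.

Lemma supp_open_gt0 (O : set E) x : supp mu x -> open O -> O x -> mu O <> 0%E.
Proof.
move=> sx oO Ox O0; have := sx (~` O); apply => //; split;
  first exact: open_closedC.
have mO := borel_open oO.
by rewrite [LHS](probability_setC mu mO) [mu O]O0 sube0.
Qed.

Lemma closed_supp : closed (supp mu).
Proof. by apply: closed_bigI => F []. Qed.

Lemma open_suppC : open (~` supp mu).
Proof. by apply: closed_openC; exact: closed_supp. Qed.

(* The complement is a countable union of compact sets, each of them covered by
   finitely many open null sets. *)
Lemma supp_full : mu (~` supp mu) = 0%E.
Proof.
pose K (j : nat) : set E := closed_ball 0 j.+1%:R `\` \bigcup_(a in supp mu)
  ball a j.+1%:R^-1.
have cK j : compact (K j).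
  apply: bounded_closed_compact.
    exists j.+1%:R; split=> // x jx y [+ _].
    rewrite closed_ballE// /closed_ball_/= sub0r normrN => h.
    exact: le_trans h (ltW jx).
  apply: closedI; first exact: closed_ball_closed.
  by apply: open_closedC; apply: bigcup_open => a _; exact: ball_open.
apply/negligibleP; first by apply: borel_open; exact: open_suppC.
apply: (@negligibleS _ _ _ mu (\bigcup_j (K j))).
  move=> x nx.
  have /nbhs_ballP[e /= e0 be] : nbhs x (~` supp mu).
    by apply: open_nbhs_nbhs; split=> //; exact: open_suppC.
  (* This [j] bounds the norm of [x] and makes 1 / (j + 1) smaller than [e] at once. *)
  pose j := Num.truncn (`|x| + e^-1).
  have jj : `|x| + e^-1 < j.+1%:R by exact: truncnS_gt.
  have e10 : 0 < e^-1 by rewrite invr_gt0.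
  exists j => //; split.
    rewrite closed_ballE// /closed_ball_/= sub0r normrN.
    by have := normr_ge0 x; lra.
  move=> [a sa]; rewrite -ball_normE/= => ax; apply: (be a) => //.
  rewrite -ball_normE/= distrC; apply: lt_le_trans ax _.
  rewrite -[leRHS]invrK lef_pV2 ?posrE//.
  by have := normr_ge0 x; lra.
apply: negligible_bigcup => j.
apply: (@compact_induction _ (fun B => mu.-negligible (B : set (borel E))) _
  (cK j)).
- exact: negligible_set0.
- by move=> A B AB; exact: negligibleS.
- by move=> A B; exact: negligibleU.
move=> x [_ nx].
have : ~ supp mu x by move=> sx; apply: nx; exists x => //; exact: ballxx.
move=> /existsNP[F /not_implyP[[cF F1] nFx]].
exists (~` F); first by apply: open_nbhs_nbhs; split => //; exact: closed_openC.
apply: (@negligibleS _ _ _ mu (~` F)); first exact: subIsetl.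
have mF : measurable (F : set (borel E)).
  by rewrite -(setCK F); apply: measurableC; apply: borel_open;
    exact: closed_openC.
apply/negligibleP; first exact: measurableC.
by rewrite [LHS](probability_setC mu mF) F1 subee.
Qed.

Section invariant.
Context (U : set E) (openU : open U).

(** If [T x] missed a closed set of full measure, the preimage of its complement would be an open
    null neighbourhood of [x]. *)
Lemma supp_invariant (T : E -> E) x :
  (forall x, U x -> {for x, continuous T}) ->
  invariant_on mu U T -> U x -> supp mu x -> supp mu (T x).
Proof.
move=> cT invT Ux sx F [cF F1]; apply: contrapT => nF.
have oF : open (~` F) by exact: closed_openC.
have oO := open_preimage_on openU cT oF.
apply: (supp_open_gt0 sx oO) => //.
have mF : measurable (F : set (borel E)).
  by rewrite -(setCK F); apply: measurableC; exact: borel_open.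
rewrite [LHS](invT _ (borel_open oF)).
by rewrite [LHS](probability_setC mu mF) F1 subee.
Qed.

(** The image [G] of the support under the delay map of [S] is compact, hence closed, and its
    complement is null for the delay measure of [S]. If the [T]-delay vector of [z] were outside
    [G], an open neighbourhood of [z] would be null. *)
Lemma delay_measure_eq_supp k (y : E -> R) (T S : E -> E) z :
  compact (supp mu) -> supp mu `<=` U ->
  (forall i x, U x -> {for x, continuous (fun x => y (iter i T x))}) ->
  (forall i x, U x -> {for x, continuous (fun x => y (iter i S x))}) ->
  (forall B : set (borel 'rV[R]_k), measurable B ->
    delay_measure mu U y T B = delay_measure mu U y S B) ->
  supp mu z -> exists2 w, supp mu w &
    forall i, (i < k)%N -> y (iter i T z) = y (iter i S w).
Proof.
move=> cs sU cT cS eqTS sz.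
have cdelay (T' : E -> E) : (forall i x, U x ->
  {for x, continuous (fun x => y (iter i T' x))}) ->
    forall x, U x -> {for x, continuous (delay_map k y T')}.
  move=> cT' x Ux; apply: continuous_mx_entry => i j.
  rewrite (_ : (fun x => _) = (fun x => y (iter j T' x))); first exact: cT'.
  by apply/funext => x'; rewrite mxE.
pose G := delay_map k y S @` supp mu.
have cG : compact G.
  apply: continuous_compact cs; apply: continuous_in_subspaceT => x /set_mem/sU.
  exact: cdelay.
have clG : closed G by apply: compact_closed => //; exact: norm_hausdorff.
have oG : open (~` G) by exact: closed_openC.
have [[w sw wz]|nG] := pselect (G (delay_map k y T z)).
  exists w => // i ik.
  by move/rowP: wz => /(_ (Ordinal ik)); rewrite !mxE.
exfalso; have oO := open_preimage_on openU (cdelay T cT) oG.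
apply: (supp_open_gt0 sz oO); first by split=> //; exact: sU.
rewrite [LHS](eqTS _ (borel_open oG)).
apply/negligibleP; first by apply: borel_open;
  exact: open_preimage_on (cdelay S cS) oG.
apply: (@negligibleS _ _ _ mu (~` supp mu)).
  by move=> x [Ux nGx] sx; apply: nGx; exists x.
apply/negligibleP; last exact: supp_full.
by apply: borel_open; exact: open_suppC.
Qed.

Lemma measurable_fun_borel (f : E -> R) : {in U, continuous f} ->
  measurable_fun (U : set (borel E)) f.
Proof.
move=> cf; apply: (measurability _ (RGenOpens.measurableE R)).
move=> _ [_ [a [b ->] <-]]; apply: borel_open.
apply: open_preimage_on => //.
by move=> x Ux; apply: cf; rewrite inE.
Qed.

(** A nonnegative function with integral 0 vanishes almost everywhere; by continuity the set where
    it is nonzero is open, so a null one misses the support. *)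
Lemma basin_agree (T S : E -> E) x : mu U = 1%E ->
  (forall x, U x -> {for x, continuous T}) ->
  (forall x, U x -> {for x, continuous S}) ->
  basin mu U T x -> (forall k, T (iter k T x) = S (iter k T x)) ->
  supp mu `<=` U -> forall y, supp mu y -> T y = S y.
Proof.
move=> U1 cT cS [Ux bx] TS sU y sy; apply: contrapT => nTS.
(* [T - S] may be unbounded on [U]; the truncation at 1 bounds the integral. *)
pose phi z : R := Num.min 1 `|T z - S z|.
have cphi z : U z -> {for z, continuous phi}.
  move=> Uz; apply: (@continuous_min _ _ (fun=> 1) (fun z => `|T z - S z|)).
    exact: cst_continuous.
  apply: continuous_comp; last exact: norm_continuous.
  by apply: continuousB; [exact: cT|exact: cS].
have phi0 z : 0 <= phi z by rewrite le_min ler01 normr_ge0.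
have phi1 z : phi z <= 1 by rewrite ge_min lexx.
have mU : measurable (U : set (borel E)) by exact: borel_open.
have mphi : measurable_fun (U : set (borel E)) phi.
  by apply: measurable_fun_borel => z /set_mem; exact: cphi.
have I0 : \int[mu]_(z in U) phi z = 0 :> R.
  have := bx phi; rewrite (_ : (fun N : nat => _) = cst 0); last first.
    apply/funext => N; rewrite big1 ?mulr0// => k _.
    by rewrite /phi TS subrr normr0 min_r.
  move=> h; have /h/cvg_lim <- // : {within U, continuous phi}.
    by apply: continuous_in_subspaceT => z /set_mem; exact: cphi.
  by rewrite lim_cst.
(* The real integral is [fine] of the extended one and [fine] sends +oo to 0, so finiteness has to
   be checked. *)
have I0' : (\int[mu]_(z in U) (phi z)%:E = 0)%E.
  rewrite -[LHS]fineK; first by rewrite [fine _]I0.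
  rewrite ge0_fin_numE; last by apply: integral_ge0 => z _; rewrite lee_fin.
  apply: (@le_lt_trans _ _ (\int[mu]_(z in U) 1)%E).
    apply: ge0_le_integral => //.
    - by move=> z _; rewrite lee_fin.
    - exact/measurable_EFinP.
    - by move=> z _; rewrite lee_fin.
  rewrite integral_cst// mul1e; apply: (eq_ind_r (fun x => (x < +oo)%E) _ U1).
  by rewrite ltry.
have ae0 : mu.-negligible (U `&` phi @^-1` [set t | t != 0]).
  have mE : measurable_fun (U : set (borel E)) (EFin \o phi)
    by exact/measurable_EFinP.
  have [+ _] := ae_eq_integral_abs mu mU mE.
  have -> : (\int[mu]_(z in U) `|(EFin \o phi) z| = 0)%E.
    by rewrite -I0'; apply: eq_integral => z _; rewrite /= ger0_norm.
  move=> /(_ erefl); apply: negligibleS => z [Uz /= /eqP pz] /(_ Uz).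
  by move=> [].
have oO : open (U `&` phi @^-1` [set t | t != 0]).
  by apply: open_preimage_on => //; exact: open_neq.
apply: (supp_open_gt0 sy oO).
  split; first exact: sU.
  apply: lt0r_neq0; rewrite lt_min ltr01 normr_gt0 subr_eq0; exact/eqP.
by apply/negligibleP => //; exact: borel_open.
Qed.

End invariant.
End support.

(** * Prevalence *)

(** The common probe is what allows the countably many exceptional null sets of parameters to be
    united. *)
Lemma prevalent_bigcap_open (R : realType) (V : topologicalLmodType R) k
    (e : 'I_k -> V) (O : nat -> set V) :
  (forall c : 'I_k -> R, \sum_i c i *: e i = 0 -> forall i, c i = 0) ->
  (forall i, open (O i)) ->
  (forall i v, {ae @lebesgue_tuple R k, forall c : k.-tuple (measurableTypeR R),
    O i (v + \sum_i (tnth c i : R) *: e i)}) ->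
  prevalent (\bigcap_i O i).
Proof.
move=> fe oO aeO; split.
  have h i : <<s @open V >> (~` O i).
    by rewrite -setTD; exact: (sigma_algebraCD
      (@sub_sigma_algebra _ setT (@open V) _ (oO i))).
  rewrite -(setCK (\bigcap_i O i)) setC_bigcap -setTD.
  exact: (sigma_algebraCD (sigma_algebra_bigcup h)).
exists k, e; split=> // v.
apply: negligibleS (negligible_bigcup (aeO ^~ v)) => c /= nO.
apply: contrapT => h; apply: nO => i _; apply: contrapT => nOi.
by apply: h; exists i.
Qed.

Lemma compact_subsingleton (X : topologicalType) (A : set X) :
  (forall x y, A x -> A y -> x = y) -> compact A.
Proof.
move=> A1; have [[x Ax]|nA] := pselect (exists x, A x).
  rewrite (_ : A = [set x]); first exact: compact_set1.
  by apply/seteqP; split=> [y Ay|y ->//]; exact: A1.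
rewrite (_ : A = set0); first exact: compact0.
by apply/seteqP; split=> // y Ay; apply: nA; exists y.
Qed.

(** * Countable cover of the support by admissible pieces *)

Section cover.
Context {R : realType} {n m : nat} (U : set 'rV[R]_n).
Local Notation E := ('rV[R]_n).
Context (S : E -> E) (SU : forall x, U x -> U (S x))
  (lS : forall x, U x -> locally_lipschitz_at S x) (openU : open U)
  (injS : forall x y, U x -> U y -> S x = S y -> x = y).

Lemma iter_inj_on l x y : U x -> U y -> iter l S x = iter l S y -> x = y.
Proof.
move=> Ux Uy; elim: l => //= l IH /injS h; apply: IH; apply: h; exact: iter_U.
Qed.

(** What [open_separating] and [negligible_probe_shift] ask of a piece. The bound [q <= m] is there
    because only [m] delay coordinates of [w] and [z] will be known to agree. *)
Definition admissible q (K : set E) (z : E) :=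
  [/\ compact K, K `<=` U, (q <= m)%N, thin q K &
   forall w a b, K w -> (a < q)%N -> (b < q)%N ->
     (iter a S w = iter b S w -> a = b) /\ iter a S w <> iter b S z].

Context (A : set E) (AU : A `<=` U) (cA : compact A) (d : R)
  (dimA : has_boxdim A d)
  (d0 : 0 <= d) (md : 2 * d < m%:R) (PS : periodic_point_condition S A m)
  (z : E) (Uz : U z).

(** This set and the next two are written as unions of preimages of open sets, hence open: removing
    them from [A] leaves compact sets. *)
Let nonperiodic q : set E :=
  U `&` (fun w => `|iter q S w - w|) @^-1` [set t : R | t != 0].

Let self_close q (j : nat) : set E :=
  \bigcup_(ab in [set ab : 'I_q * 'I_q | ab.1 != ab.2])
    (U `&` (fun w => `|iter ab.1 S w - iter ab.2 S w|) @^-1`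
      [set t : R | t < j.+1%:R^-1]).

Let close_to_orbit q (j : nat) : set E :=
  \bigcup_(ab in [set: 'I_q * 'I_q])
    (U `&` (fun w => `|iter ab.1 S w - iter ab.2 S z|) @^-1`
      [set t : R | t < j.+1%:R^-1]).

(** The [q]-periodic points for [q < m], of box dimension below q / 2 by (P), and all of [A] for
    [q = m], of dimension below m / 2. *)
Let base q : set E := if (q < m)%N then A `\` nonperiodic q else A.

Let contS l x : U x -> {for x, continuous (iter l S)}.
Proof. exact: continuous_iter. Qed.

Let compact_base q : compact (base q).
Proof.
rewrite /base; case: ifP => // _; apply: compact_closedI => //.
apply: open_closedC; apply: (open_preimage_on openU); last exact: open_neq.
move=> x Ux; apply: continuous_comp; last exact: norm_continuous.
by apply: continuousB; [exact: contS|exact: cvg_id].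
Qed.

Let base_sub q : base q `<=` A.
Proof. by rewrite /base; case: ifP => _ x // []. Qed.

Let thin_base q : (0 < q <= m)%N -> thin q (base q).
Proof.
move=> /andP[q0 qm]; rewrite /base; case: ifP => [qm'|qm'].
  have /PS[[d' dim' dq'] _] : (1 <= q <= m)%N by rewrite q0.
  apply: (boxdim_thin (d := d')) => //.
  - by have := @compact_base q; rewrite /base qm'.
  - rewrite (_ : A `\` _ = periodic_points S A q) //; apply/seteqP;
      split=> x [Ax h]; split=> //.
      by apply/eqP; rewrite -subr_eq0 -normr_eq0; apply/negPn/negP => h';
        apply: h; split=> //; exact: AU.
    by move=> [_ /=]; rewrite h subrr normr0 eqxx.
  - have : 0 < q%:R :> R by rewrite ltr0n.
    by lra.
have -> : q = m by apply/eqP; rewrite eqn_leq qm leqNgt qm'.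
apply: (boxdim_thin (d := d)) => //; first exact: leq_trans qm.
by move: d0 md => ? ?; lra.
Qed.

(* If S^a w = S^b z with a, b < m, then w is determined by (a, b). Otherwise the
   first q iterates of w are distinct and avoid those of z, q being the minimum
   of m and the period of w, by a margin of at least 1 / (j + 1) for some j. *)
Let piece (i : 'I_m * 'I_m + 'I_m * nat) : nat * set E :=
  match i with
  | inl (a, b) => (1%N, [set w | [/\ A w, w <> z & iter a S w = iter b S z]])
  | inr (q, j) => (q.+1, base q.+1 `\`
    (self_close q.+1 j `|` close_to_orbit q.+1 j))
  end.

Let admissible_piece i : admissible (piece i).1 (piece i).2 z.
Proof.
case: i => [[a b]|[q j]] /=.
  have K1 x y : [/\ A x, x <> z & iter a S x = iter b S z] ->
      [/\ A y, y <> z & iter a S y = iter b S z] -> x = y.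
    by move=> [/AU Ux _ xz] [/AU Uy _ yz]; apply: (@iter_inj_on a) => //;
      rewrite xz yz.
  split.
  - exact: compact_subsingleton.
  - by move=> w [/AU].
  - exact: leq_ltn_trans (ltn_ord a).
  - exact: thin_subsingleton.
  (* For [q = 1] the only indices are 0, and what remains is [w <> z]. *)
  - by move=> w [|//] [|//] [_ wz _] _ _; split.
split.
- apply: compact_closedI; first exact: compact_base.
  apply: open_closedC; apply: topology_structure.openU;
    apply: bigcup_open => -[a b] _;
    apply: (open_preimage_on openU); try exact: open_lt.
    move=> x Ux; apply: continuous_comp; last exact: norm_continuous.
    by apply: continuousB; exact: contS.
  move=> x Ux; apply: continuous_comp; last exact: norm_continuous.
  by apply: continuousB; [exact: contS|exact: cst_continuous].
- by move=> w [/base_sub/AU].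
- exact: ltn_ord.
- by apply: thin_subset (thin_base _); [exact: subDsetl|rewrite ltn_ord].
have jp : 0 < j.+1%:R^-1 :> R by rewrite invr_gt0.
move=> w a b [/base_sub/AU Uw nw] aq bq; split=> h.
  apply/eqP/negPn/negP => ab; apply: nw; left.
  by exists (Ordinal aq, Ordinal bq) => //; split=> //=; rewrite h subrr normr0.
apply: nw; right.
by exists (Ordinal aq, Ordinal bq) => //; split=> //=; rewrite h subrr normr0.
Qed.

Let cover_piece w : A w -> w <> z -> exists i, (piece i).2 w.
Proof.
move=> Aw wz; have Uw := AU Aw.
have [[a [b ab]]|nab] := pselect (exists a b : 'I_m, iter a S w = iter b S z).
  by exists (inl (a, b)).
have m0 : (0 < m)%N by rewrite -(ltr0n R); move: d0 md => ? ?; lra.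
have [q [/andP[q0 qm] bq qmin]] : exists q, [/\ (0 < q <= m)%N, base q w &
    forall p, (0 < p < q)%N -> iter p S w <> w].
  pose pr p := [&& (0 < p)%N, (p < m)%N & iter p S w == w].
  have [ex|nex] := pselect (exists p, pr p).
    case: (ex_minnP ex) => p /and3P[p0 pm /eqP pw] pmin; exists p; split.
    - by rewrite p0 ltnW.
    - by rewrite /base pm; split=> // -[_ /=]; rewrite pw subrr normr0 eqxx.
    - move=> r /andP[r0 rp] rw; have : pr r by rewrite /pr r0 (ltn_trans rp pm)
        rw eqxx.
      by move=> /pmin; rewrite leqNgt rp.
  exists m; split; first by rewrite m0 leqnn.
    by rewrite /base ltnn.
  by move=> p /andP[p0 pm] pw; apply: nex; exists p; rewrite /pr p0 pm pw eqxx.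
(* As S^a is injective on [U], equality would make b - a a period of [w] smaller than [q]. *)
have injw a b : (a < b < q)%N -> iter a S w <> iter b S w.
  move=> /andP[ab bq'] h; apply: (qmin (b - a)%N).
    by rewrite subn_gt0 ab (leq_ltn_trans (leq_subr _ _) bq').
  apply/esym; apply: (@iter_inj_on a) => //; first exact: iter_U.
  by rewrite -iterD subnKC// ltnW.
pose c1 (ab : 'I_q * 'I_q) := `|iter ab.1 S w - iter ab.2 S w|.
pose c2 (ab : 'I_q * 'I_q) := `|iter ab.1 S w - iter ab.2 S z|.
(* [M] dominates the inverse of every gap, so each positive gap exceeds 1 / (j + 1). Diagonal pairs
   add [0^-1 = 0] to the [c1] part. *)
pose M := \sum_ab ((c1 ab)^-1 + (c2 ab)^-1).
pose j := Num.truncn M.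
have Mj : M < j.+1%:R by exact: truncnS_gt.
have c1p ab : 0 <= (c1 ab)^-1 by rewrite invr_ge0 /c1 normr_ge0.
have c2p ab : 0 <= (c2 ab)^-1 by rewrite invr_ge0 /c2 normr_ge0.
have cM ab : (c1 ab)^-1 + (c2 ab)^-1 <= M.
  by rewrite /M (bigD1 ab)//= lerDl sumr_ge0// => *; rewrite addr_ge0.
have jc c : c \is Num.pos -> c^-1 <= M -> ~ (c < j.+1%:R^-1).
  rewrite posrE => c0 cMle; apply/negP;
    rewrite -leNgt -[leRHS]invrK lef_pV2 ?posrE ?invr_gt0//.
  exact: ltW (le_lt_trans cMle Mj).
have qm1 : (q.-1 < m)%N by rewrite prednK.
exists (inr (Ordinal qm1, j)) => /=; rewrite prednK//; split=> //.
move=> [[[a b] /= ab [_]]|[[a b] _ [_]]] /=.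
  apply: (jc (c1 (a, b))).
    rewrite posrE normr_gt0 subr_eq0 /=; apply/eqP.
    case: (ltngtP a b) => [lt|lt|/val_inj eab]; last by rewrite eab eqxx in ab.
      by apply: injw; rewrite lt ltn_ord.
    by move/esym; apply: injw; rewrite lt ltn_ord.
  by have := cM (a, b); have := c2p (a, b); lra.
apply: (jc (c2 (a, b))).
  rewrite posrE normr_gt0 subr_eq0 /=; apply/eqP => h; apply: nab.
  by exists (Ordinal (leq_trans (ltn_ord a) qm)),
    (Ordinal (leq_trans (ltn_ord b) qm)).
by have := cM (a, b); have := c1p (a, b); lra.
Qed.

Lemma admissible_cover : exists F : ('I_m * 'I_m + 'I_m * nat) -> nat * set E,
  (forall i, admissible (F i).1 (F i).2 z) /\
  forall w, A w -> w <> z -> exists i, (F i).2 w.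
Proof. by exists piece. Qed.

End cover.

Theorem theorem5p2 (R : realType) (n m : nat) (U : set 'rV[R]_n)
    (T S : 'rV[R]_n -> 'rV[R]_n) (mu : probability (borel 'rV[R]_n) R) (d : R)
    (openU : open U)
    (diffeoT : diffeomorphism_on U T) (diffeoS : diffeomorphism_on U S)
    (muU : mu U = 1%E)
    (invT : invariant_on mu U T) (invS : invariant_on mu U S)
    (suppU : supp mu `<=` U) (compact_supp : compact (supp mu))
    (dimd : has_boxdim (supp mu) d) (md : 2 * d < m%:R)
    (PT : periodic_point_condition T (supp mu) m)
    (PS : periodic_point_condition S (supp mu) m) :
  for_almost_every (fun Y : C1_space U m =>
    (exists2 x, (basin mu U T `&` supp mu) x &
       forall k, (1 <= k <= m - 1)%N -> iter k T x = iter k S x) ->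
    (forall (j : 'I_m) (B : set (borel 'rV[R]_m.+1)), measurable B ->
       delay_measure mu U (fun x => Y x 0 j) T B =
       delay_measure mu U (fun x => Y x 0 j) S B) ->
    forall x, supp mu x -> T x = S x).
Proof.
(* The existence of [x] does not depend on [Y]. Without such a point the implication is vacuous, and
   the whole space is prevalent with the zero probe. *)
have [[x [bx sx] TSx]|nx] := pselect (exists2 x, (basin mu U T `&` supp mu) x &
    forall k, (1 <= k <= m - 1)%N -> iter k T x = iter k S x); last first.
  exists setT => // ; split; first by apply: sub_sigma_algebra; exact: openT.
  exists 0%N, (fun=> 0); split=> [c _ []//|v].
  by apply: negligibleS (@negligible_set0 _ _ _ _) => c /= /(_ I).
have [T' [TU _ _ _ [C1T _]]] := diffeoT.
have [S' [SU _ S'S _ [C1S _]]] := diffeoS.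
have lT y : U y -> locally_lipschitz_at T y by exact: C1_on_locally_lipschitz.
have lS y : U y -> locally_lipschitz_at S y by exact: C1_on_locally_lipschitz.
have injS y y' : U y -> U y' -> S y = S y' -> y = y'.
  by move=> Uy Uy' e; rewrite -(S'S _ Uy) e S'S.
have cT y (Uy : U y) := locally_lipschitz_continuous (lT y Uy).
have cS y (Uy : U y) := locally_lipschitz_continuous (lS y Uy).
have d0 : 0 <= d := boxdim_ge0 sx dimd.
have m0 : (0 < m)%N by rewrite -(ltr0n R); lra.
pose j0 := Ordinal m0.
have Ux := suppU x sx.
have sT k : supp mu (iter k T x).
  by elim: k => //= k IH; exact: (supp_invariant openU cT invT (suppU _ IH) IH).
have UT k := suppU _ (sT k).
have /choice[F FP] k := admissible_cover SU lS openU injS suppU compact_supp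
  dimd d0 md PS (iter k T x).
(* Empty if T^k x = S^k x, a single point otherwise; separating it from T^k x with [q = 1] means
   that [y] takes distinct values at the two points. *)
pose pair k : set 'rV[R]_n := [set w | w = iter k S x /\ w <> iter k T x].
pose O' (i : nat * ('I_m * 'I_m + 'I_m * nat) + nat) : set (C1_space U m) :=
  match i with
  | inl (k, i) => separating S j0 (F k i).1 (F k i).2 (iter k T x)
  | inr k => separating S j0 1 (pair k) (iter k T x)
  end.
pose O i := if unpickle i is Some j then O' j else setT.
have pair1 k y z : pair k y -> pair k z -> y = z by move=> [-> _] [-> _].
have pairU k : pair k `<=` U by move=> _ [-> _]; exact: iter_U.
(* Pieces have [q <= m] and involve at most 2q points, so degree 2m serves all of them. *)
have [K [e [fe eP]]] := exists_probe openU j0 m.*2.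
exists (\bigcap_i O i).
  apply: (prevalent_bigcap_open fe).
    move=> i; rewrite /O; case: unpickle => [[[k j]|k]|] /=; last exact: openT.
      by have [/(_ j)[cK KU _ _ _] _] := FP k; exact: open_separating.
    by apply: open_separating => //; exact: compact_subsingleton (pair1 k).
  move=> i v; rewrite /O; case: unpickle => [[[k j]|k]|] /=; last first.
  - by apply: negligibleS (@negligible_set0 _ _ _ _) => c /= /(_ I).
  - apply: (negligible_probe_shift SU lS openU eP) => //.
    + by rewrite leq_double.
    + exact: compact_subsingleton (pair1 k).
    + exact: thin_subsingleton (pair1 k).
    + by move=> w [|//] [|//].
    + by move=> w [|//] [|//] [].
  - have [/(_ j)[cK KU qm tK dK] _] := FP k.
    apply: (negligible_probe_shift SU lS openU eP) => //.
    + by rewrite leq_double.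
    + by move=> w a b Kw aq bq; have [] := dK w a b Kw aq bq.
    + by move=> w a b Kw aq bq; have [] := dK w a b Kw aq bq.
move=> Y GY _ eqTS.
have O'Y i : O' i Y by have := GY (pickle i) I; rewrite /O pickleK.
have cY (T0 : 'rV[R]_n -> 'rV[R]_n) : (forall y, U y -> U (T0 y)) ->
    (forall y, U y -> locally_lipschitz_at T0 y) ->
    forall i y, U y -> {for y, continuous (fun y => Y (iter i T0 y) 0 j0 : R)}.
  move=> T0U lT0 i y Uy; apply: locally_lipschitz_continuous.
  exact: locally_lipschitz_eval.
have orbits k : iter k T x = iter k S x.
  elim/ltn_ind: k => k IH; have [km|mk] := ltnP k m.
    (* Below [m] this is hypothesis 1, except for the trivial case [k = 0]. *)
    case: k km {IH} => // k km; apply: TSx; rewrite /=.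
    by rewrite -ltnS subn1 prednK.
  have kmk : (k - m < k)%N by rewrite ltn_subrL m0 (leq_trans m0 mk).
  pose z := iter (k - m) T x.
  have [w sw wz] := delay_measure_eq_supp openU compact_supp suppU (cY T TU lT)
    (cY S SU lS) (eqTS j0) (sT (k - m)%N).
  have Tz i : (i < m)%N -> iter i T z = iter i S z.
    move=> im; rewrite /z -iterD IH;
      last by rewrite -[ltnRHS](subnKC mk) ltn_add2r.
    by rewrite iterD (IH _ kmk).
  have wE : w = z.
    apply: contrapT => wnz; have [_ /(_ w sw wnz)[j Kw]] := FP (k - m)%N.
    have [/(_ j)[_ _ qm _ _] _] := FP (k - m)%N.
    have [l] := O'Y (inl ((k - m)%N, j)) w Kw; apply.
    have lm := leq_trans (ltn_ord l) qm.
    by rewrite -wz ?(ltn_trans lm)// Tz.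
  (* The first [m] coordinates have identified [w]; the last of the [m + 1] carries the new
     information. *)
  have := wz m (ltnSn m); rewrite wE /z -iterD (subnKC mk) [in RHS](IH _ kmk).
  rewrite -iterD (subnKC mk) => TSk.
  apply: contrapT => nTS.
  have [|l] := O'Y (inr k) (iter k S x); first by split=> // /esym.
  by rewrite (ord1 l) /= => /(_ (esym TSk)).
apply: (@basin_agree _ _ mu U openU T S x) => // k.
by rewrite -iterS orbits iterS -orbits.
Qed.
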